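(* Let $H$ be a finite-dimensional Hopf algebra over any field, and $F\in H\otimes H$ a 2-cocycle of $H$. Then for any pair of coprime integers $n,k$ with $n>1$, $$\tilde\nu_{n,k}(H_F)=\tilde\nu_{n,k}(H).$$
   Context: For an integer $a$, $\overline a\in\{1,\dots,n\}$ denotes the positive residue of $a$ modulo $n$. For a finite-dimensional Hopf algebra $H$ with antipode $S$ and coprime integers $n,k$ with $n>1$, define the linear operator $\tilde P^{(n,k)}:H\to H$ by $$\tilde P^{(n,k)}(x)=\sum_{(x)}x_{(\overline{k})}x_{(\overline{2k})}\cdots x_{(\overline{(n-1)k})},$$ where $\Delta^{n-1}(x)=x_{(1)}\otimes\cdots\otimes x_{(n-1)}$ is the iterated comultiplication ($\Delta^1=\mathrm{id}$, $\Delta^{j+1}=(\mathrm{id}\otimes\Delta^j)\Delta$), and set $\tilde\nu_{n,k}(H)=\mathrm{Tr}(S\circ\tilde P^{(n,k)})$. A 2-cocycle of $H$ is an invertible $F\in H\otimes H$ with $(\varepsilon\otimes\mathrm{id})(F)=(\mathrm{id}\otimes\varepsilon)(F)=1$ and $(1\otimes F)(\mathrm{id}\otimes\Delta)(F)=(F\otimes1)(\Delta\otimes\mathrm{id})(F)$. The Drinfeld twist $H_F$ is the Hopf algebra equal to $H$ as an algebra, with the same counit, comultiplication $\Delta_F(h)=F\Delta(h)F^{-1}$ and antipode $S_F(h)=uS(h)u^{-1}$, where $u=\sum_i f^{[1]}_iS(f^{[2]}_i)$ for $F=\sum_if_i^{[1]}\otimes f_i^{[2]}$. *)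

(* Defs.v *)
From HB Require Import structures.
From mathcomp Require Import all_boot all_order all_algebra all_field.

Set Implicit Arguments.
Unset Strict Implicit.
Unset Printing Implicit Defensive.

Import GRing.Theory.
Local Open Scope ring_scope.

Section TensorDef.
Variables (K : fieldType) (U V : vectType K).

(* U (x) V, in coordinates: the matrix t stands for                           *)
(* \sum_(i, j) t i j *: (e_i (x) f_j), where e and f are the library's bases  *)
(* of U and V. The lemmas tlift_pure and tlift_uniq are the universal         *)
(* property of U (x) V, which does not refer to the bases.                    *)
Definition tensor : Type := 'M[K]_(\dim {:U}, \dim {:V}).

HB.instance Definition _ := Vector.on tensor.

Definition tpure (u : U) (v : V) : tensor :=
  \matrix_(i, j) (coord (vbasis {:U}) i u * coord (vbasis {:V}) j v).

End TensorDef.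

Notation "u *t v" := (tpure u v) (at level 40, left associativity) : ring_scope.

Section TensorTheory.
Variables (K : fieldType) (U V W : vectType K).
Implicit Types (s t : tensor U V).

Lemma tpureDl (u1 u2 : U) (v : V) : (u1 + u2) *t v = u1 *t v + u2 *t v.
Proof. by apply/matrixP => i j; rewrite !mxE linearD mulrDl. Qed.

Lemma tpureDr (u : U) (v1 v2 : V) : u *t (v1 + v2) = u *t v1 + u *t v2.
Proof. by apply/matrixP => i j; rewrite !mxE linearD mulrDr. Qed.

Lemma tpureZl a (u : U) (v : V) : (a *: u) *t v = a *: (u *t v).
Proof. by apply/matrixP => i j; rewrite !mxE linearZ mulrA. Qed.

Lemma tpureZr a (u : U) (v : V) : u *t (a *: v) = a *: (u *t v).
Proof. by apply/matrixP => i j; rewrite !mxE linearZ mulrCA. Qed.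

Lemma tpure0l (v : V) : (0 : U) *t v = 0.
Proof. by apply/matrixP => i j; rewrite !mxE linear0 mul0r. Qed.

Lemma tpure0r (u : U) : u *t (0 : V) = 0.
Proof. by apply/matrixP => i j; rewrite !mxE linear0 mulr0. Qed.

Lemma tpure_eq0 (u : U) (v : V) : (u *t v == 0) = (u == 0) || (v == 0).
Proof.
apply/eqP/orP => [uv0 |]; last first.
  by case=> /eqP->; [exact: tpure0l | exact: tpure0r].
have [_ | nzu] := eqVneq u 0; [by left | right].
apply: contraNT nzu => nzv.
have [j nzj] : exists j, coord (vbasis {:V}) j v != 0.
  apply/existsP; apply: contraNT nzv; rewrite negb_exists => /forallP v0.
  apply/eqP; rewrite [v](coord_vbasis (memvf v)) big1 // => j _.
  by have /eqP-> := negbNE (v0 j); rewrite scale0r.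
apply/eqP; rewrite [u](coord_vbasis (memvf u)) big1 // => i _.
have /matrixP/(_ i j)/eqP := uv0.
by rewrite !mxE mulf_eq0 (negPf nzj) orbF => /eqP->; rewrite scale0r.
Qed.

Lemma tensor_dec t :
  t = \sum_i \sum_j t i j *: ((vbasis {:U})`_i *t (vbasis {:V})`_j).
Proof.
apply/matrixP => i j; rewrite summxE (bigD1 i) //= summxE (bigD1 j) //=.
rewrite !mxE !coord_free ?(basis_free (vbasisP _)) // !eqxx !mulr1.
rewrite !big1 ?addr0 // => [k ki | k kj]; last first.
  by rewrite !mxE !coord_free ?(basis_free (vbasisP _)) // (negPf kj) !mulr0.
rewrite summxE big1 // => l _.
by rewrite !mxE !coord_free ?(basis_free (vbasisP _)) // (negPf ki) mul0r mulr0.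
Qed.

Lemma tensor_ind (P : tensor U V -> Prop) :
    (forall u v, P (u *t v)) -> (forall s t, P s -> P t -> P (s + t)) ->
  forall t, P t.
Proof.
move=> Ppure PD t; rewrite (tensor_dec t).
have P0 : P 0 by rewrite -(tpure0l 0).
apply: (big_ind P) => // i _; apply: (big_ind P) => // j _.
by rewrite -tpureZl.
Qed.

Definition tlift_fun (f : U -> V -> W) t : W :=
  \sum_i \sum_j t i j *: f (vbasis {:U})`_i (vbasis {:V})`_j.

Lemma tlift_fun_linear f : linear (tlift_fun f).
Proof.
move=> a s t; rewrite /tlift_fun scaler_sumr -big_split; apply: eq_bigr => i _.
rewrite scaler_sumr -big_split; apply: eq_bigr => j _ /=.
by rewrite !mxE scalerDl scalerA.
Qed.

HB.instance Definition _ f := GRing.isSemilinear.Build K (tensor U V) W _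
  (tlift_fun f) (GRing.semilinear_linear (tlift_fun_linear f)).

(* The linear map u (x) v |-> f u v, for a bilinear f; for other f its value  *)
(* is not meaningful.                                                         *)
Definition tlift (f : U -> V -> W) : 'Hom(tensor U V, W) := linfun (tlift_fun f).

Lemma tlift_pure (f : U -> V -> W) :
    (forall v, linear (f^~ v)) -> (forall u, linear (f u)) ->
  forall u v, tlift f (u *t v) = f u v.
Proof.
move=> linl linr u v; rewrite lfunE /= /tlift_fun.
pose fl v := HB.pack_for {linear U -> W} (f^~ v)
  (GRing.isSemilinear.Build _ _ _ _ _ (GRing.semilinear_linear (linl v))).
pose fr u := HB.pack_for {linear V -> W} (f u)
  (GRing.isSemilinear.Build _ _ _ _ _ (GRing.semilinear_linear (linr u))).
rewrite [u in RHS](coord_vbasis (memvf u)).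
rewrite -[RHS]/(fl v _) linear_sum; apply: eq_bigr => i _; rewrite linearZ /=.
rewrite [v in RHS](coord_vbasis (memvf v)).
rewrite -[f _ _]/(fr _ _) linear_sum scaler_sumr; apply: eq_bigr => j _.
by rewrite linearZ /= scalerA !mxE.
Qed.

Lemma tlift_uniq (f g : 'Hom(tensor U V, W)) :
  (forall u v, f (u *t v) = g (u *t v)) -> f = g.
Proof.
move=> fg; apply/lfunP; apply: tensor_ind => // s t fgs fgt.
by rewrite !linearD /= fgs fgt.
Qed.

End TensorTheory.

Definition tmap (K : fieldType) (U U' V V' : vectType K)
    (f : 'Hom(U, U')) (g : 'Hom(V, V')) : 'Hom(tensor U V, tensor U' V') :=
  tlift (fun u v => f u *t g v).

Definition tassoc (K : fieldType) (U V W : vectType K) :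
    'Hom(tensor (tensor U V) W, tensor U (tensor V W)) :=
  tlift (fun t w => tlift (fun u v => u *t (v *t w)) t).

Section TensorAlgebra.
Variables (K : fieldType) (A B : falgType K).
Implicit Types (s t : tensor A B).

Definition tmul s t : tensor A B :=
  tlift (fun a b => tlift (fun c d => (a * c) *t (b * d)) t) s.

Lemma tmulDl : left_distributive tmul +%R.
Proof. by move=> s1 s2 t; rewrite /tmul linearD. Qed.

Lemma tmulDr : right_distributive tmul +%R.
Proof.
move=> s t1 t2; rewrite /tmul !lfunE /= /tlift_fun -big_split.
apply: eq_bigr => i _; rewrite -big_split; apply: eq_bigr => j _ /=.
by rewrite linearD scalerDr.
Qed.

Lemma tmulZl a s t : tmul (a *: s) t = a *: tmul s t.
Proof. by rewrite /tmul linearZ. Qed.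

Lemma tmulZr a s t : tmul s (a *: t) = a *: tmul s t.
Proof.
rewrite /tmul !lfunE /= /tlift_fun scaler_sumr; apply: eq_bigr => i _.
rewrite scaler_sumr; apply: eq_bigr => j _.
by rewrite linearZ /= !scalerA mulrC.
Qed.

Lemma tmul_pure (a c : A) (b d : B) :
  tmul (a *t b) (c *t d) = (a * c) *t (b * d).
Proof.
have inner a' b' : tlift (fun c d => (a' * c) *t (b' * d)) (c *t d)
                   = (a' * c) *t (b' * d).
  apply: (tlift_pure (f := fun c d => (a' * c) *t (b' * d))) => [v|u] x y z.
    by rewrite mulrDr tpureDl -scalerAr tpureZl.
  by rewrite mulrDr tpureDr -scalerAr tpureZr.
rewrite /tmul tlift_pure ?inner // => [v|u] x y z; rewrite !inner.
  by rewrite mulrDl tpureDl -scalerAl tpureZl.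
by rewrite mulrDl tpureDr -scalerAl tpureZr.
Qed.

Lemma tmulA : associative tmul.
Proof.
elim/tensor_ind => [a b | s1 s2 IH1 IH2] t u; last by rewrite !tmulDl IH1 IH2.
elim/tensor_ind: t => [c d | t1 t2 IH1 IH2]; last first.
  by rewrite !(tmulDl, tmulDr) IH1 IH2.
elim/tensor_ind: u => [e f | u1 u2 IH1 IH2]; last first.
  by rewrite !(tmulDl, tmulDr) IH1 IH2.
by rewrite !tmul_pure !mulrA.
Qed.

Lemma tmul1l : left_id ((1 : A) *t (1 : B)) tmul.
Proof.
elim/tensor_ind => [a b | s t IH1 IH2]; last by rewrite tmulDr IH1 IH2.
by rewrite tmul_pure !mul1r.
Qed.

Lemma tmul1r : right_id ((1 : A) *t (1 : B)) tmul.
Proof.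
elim/tensor_ind => [a b | s t IH1 IH2]; last by rewrite tmulDl IH1 IH2.
by rewrite tmul_pure !mulr1.
Qed.

Lemma tone_neq0 : (1 : A) *t (1 : B) != 0.
Proof. by rewrite tpure_eq0 !oner_eq0. Qed.

HB.instance Definition _ := GRing.Zmodule_isNzRing.Build (tensor A B)
  tmulA tmul1l tmul1r tmulDl tmulDr tone_neq0.

HB.instance Definition _ := GRing.Lmodule_isLalgebra.Build K (tensor A B)
  (fun a s t => esym (tmulZl a s t)).

HB.instance Definition _ := GRing.Lalgebra_isAlgebra.Build K (tensor A B)
  (fun a s t => esym (tmulZr a s t)).

HB.instance Definition _ := Algebra_isFalgebra.Build K (tensor A B).

Lemma tpureM (a c : A) (b d : B) : (a *t b) * (c *t d) = (a * c) *t (b * d).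
Proof. exact: tmul_pure. Qed.

Lemma tpure1 : (1 : A) *t (1 : B) = 1.
Proof. by []. Qed.

End TensorAlgebra.

Section TensorMapTheory.
Variable K : fieldType.

Lemma tmap_pure (U U' V V' : vectType K) (f : 'Hom(U, U')) (g : 'Hom(V, V'))
    (u : U) (v : V) :
  tmap f g (u *t v) = f u *t g v.
Proof.
apply: tlift_pure => [v'|u'] a x y /=.
  by rewrite linearP tpureDl tpureZl.
by rewrite linearP tpureDr tpureZr.
Qed.

Lemma tassoc_pure (U V W : vectType K) (u : U) (v : V) (w : W) :
  tassoc U V W ((u *t v) *t w) = u *t (v *t w).
Proof.
have inner w' u' v' : tlift (fun u v => u *t (v *t w')) (u' *t v')
                      = u' *t (v' *t w').
  apply: (tlift_pure (f := fun u v => u *t (v *t w'))) => [y|y] a x z /=.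
    by rewrite tpureDl tpureZl.
  by rewrite tpureDl tpureZl tpureDr tpureZr.
rewrite /tassoc tlift_pure ?inner // => [w'|t] a x y; first by rewrite linearP.
elim/tensor_ind: t => [u' v' | s t IHs IHt].
  by rewrite !inner tpureDr tpureZr tpureDr tpureZr.
by rewrite !linearD /= IHs IHt addrACA.
Qed.

Lemma tmapM (A A' B B' : falgType K) (f : 'Hom(A, A')) (g : 'Hom(B, B')) :
    {morph f : x y / x * y} -> {morph g : x y / x * y} ->
  {morph tmap f g : s t / s * t}.
Proof.
move=> fM gM; elim/tensor_ind => [a b | s1 s2 IH1 IH2] t; last first.
  by rewrite mulrDl !linearD /= IH1 IH2 mulrDl.
elim/tensor_ind: t => [c d | t1 t2 IH1 IH2]; last first.
  by rewrite mulrDr !linearD /= IH1 IH2 mulrDr.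
by rewrite tpureM !tmap_pure fM gM tpureM.
Qed.

Lemma tassocM (A B C : falgType K) : {morph tassoc A B C : s t / s * t}.
Proof.
elim/tensor_ind => [ab c | s1 s2 IH1 IH2] t; last first.
  by rewrite mulrDl !linearD /= IH1 IH2 mulrDl.
elim/tensor_ind: t => [ab' c' | t1 t2 IH1 IH2]; last first.
  by rewrite mulrDr !linearD /= IH1 IH2 mulrDr.
elim/tensor_ind: ab => [a b | s1 s2 IH1 IH2]; last first.
  by rewrite tpureDl mulrDl !linearD /= IH1 IH2 mulrDl.
elim/tensor_ind: ab' => [a' b' | s1 s2 IH1 IH2]; last first.
  by rewrite tpureDl mulrDr !linearD /= IH1 IH2 mulrDr.
by rewrite !tpureM !tassoc_pure !tpureM.
Qed.

End TensorMapTheory.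

Record hopfData (K : fieldType) := HopfData {
  hopf_alg :> falgType K;
  comul : 'Hom(hopf_alg, tensor hopf_alg hopf_alg);
  counit : 'Hom(hopf_alg, K^o);
  antipode : 'End(hopf_alg)
}.

Section HopfAxioms.
Variables (K : fieldType) (H : hopfData K).

(* eps (x) id and id (x) eps, with values in H *)
Definition counit_l : 'Hom(tensor H H, H) := tlift (fun a b => counit H a *: b).
Definition counit_r : 'Hom(tensor H H, H) := tlift (fun a b => counit H b *: a).

Record hopf_axioms : Prop := HopfAxioms {
  comul1 : comul H 1 = 1;
  comulM : {morph comul H : x y / x * y};
  counit1 : counit H 1 = 1;
  counitM : forall x y, counit H (x * y) = counit H x * counit H y;
  comulA : forall x, tmap \1%VF (comul H) (comul H x)
                     = tassoc H H H (tmap (comul H) \1%VF (comul H x));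
  comul_counit_l : forall x, counit_l (comul H x) = x;
  comul_counit_r : forall x, counit_r (comul H x) = x;
  antipode_l : forall x,
    tlift (fun a b => antipode H a * b) (comul H x) = counit H x *: 1;
  antipode_r : forall x,
    tlift (fun a b => a * antipode H b) (comul H x) = counit H x *: 1
}.

Record is_2cocycle (F : tensor H H) : Prop := Is2Cocycle {
  cocycle_unit : F \is a GRing.unit;
  cocycle_counit_l : counit_l F = 1;
  cocycle_counit_r : counit_r F = 1;
  cocycleP : (1 *t F) * tmap \1%VF (comul H) F
             = tassoc H H H ((F *t 1) * tmap (comul H) \1%VF F)
}.

Definition twist_elt (F : tensor H H) : H := tlift (fun a b => a * antipode H b) F.

Definition twist_data (F : tensor H H) : hopfData K := @HopfData K H
  (linfun (fun x => F * comul H x * F^-1))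
  (counit H)
  (linfun (fun x => twist_elt F * antipode H x * (twist_elt F)^-1)).

End HopfAxioms.

Section TwistTheory.
Variables (K : fieldType) (H : hopfData K).
Hypothesis Hax : hopf_axioms H.
Local Notation D := (comul H).
Local Notation e := (counit H).
Local Notation S := (antipode H).

(* a (x) b |-> a z S(b) and a (x) b |-> S(a) z b *)
Let M z : 'Hom(tensor H H, H) := tlift (fun a b => a * z * S b).
Let N z : 'Hom(tensor H H, H) := tlift (fun a b => S a * z * b).
(* a (x) b (x) c |-> S(a) b S(c) *)
Let T : 'Hom(tensor H (tensor H H), H) := tlift (fun a t => S a * M 1 t).

Let M_pure z a b : M z (a *t b) = a * z * S b.
Proof.
apply: (tlift_pure (f := fun a b => a * z * S b)) => [v|u] k x y /=.
  by rewrite !mulrDl -!scalerAl.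
by rewrite linearP mulrDr -scalerAr.
Qed.

Let N_pure z a b : N z (a *t b) = S a * z * b.
Proof.
apply: (tlift_pure (f := fun a b => S a * z * b)) => [v|u] k x y /=.
  by rewrite linearP !mulrDl -!scalerAl.
by rewrite mulrDr -scalerAr.
Qed.

Let T_pure a t : T (a *t t) = S a * M 1 t.
Proof.
apply: (tlift_pure (f := fun a t => S a * M 1 t)) => [v|u] k x y /=.
  by rewrite linearP !mulrDl -!scalerAl.
by rewrite linearP mulrDr -scalerAr.
Qed.

Let T_assoc t c : T (tassoc H H H (t *t c)) = N 1 t * S c.
Proof.
elim/tensor_ind: t => [a b | s t IHs IHt]; last first.
  by rewrite tpureDl !linearD /= IHs IHt mulrDl.
by rewrite tassoc_pure T_pure M_pure N_pure !mulr1 mulrA.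
Qed.

Let M1E t : M 1 t = tlift (fun a b => a * S b) t.
Proof.
by rewrite /M !lfunE; apply: eq_bigr => i _; apply: eq_bigr => j _; rewrite mulr1.
Qed.

Let N1E t : N 1 t = tlift (fun a b => S a * b) t.
Proof.
by rewrite /N !lfunE; apply: eq_bigr => i _; apply: eq_bigr => j _; rewrite mulr1.
Qed.

Let ZM z k t : M (k *: z) t = k *: M z t.
Proof.
elim/tensor_ind: t => [a b | s t IHs IHt]; last by rewrite !linearD /= IHs IHt.
by rewrite !M_pure -scalerAr -scalerAl.
Qed.

Let ZN z k t : N (k *: z) t = k *: N z t.
Proof.
elim/tensor_ind: t => [a b | s t IHs IHt]; last by rewrite !linearD /= IHs IHt.
by rewrite !N_pure -scalerAr -scalerAl.
Qed.

Let M1D x : M 1 (D x) = e x *: 1. Proof. by rewrite M1E antipode_r. Qed.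
Let N1D x : N 1 (D x) = e x *: 1. Proof. by rewrite N1E antipode_l. Qed.

Lemma counit_l_pure a b : counit_l H (a *t b) = e a *: b.
Proof.
apply: (tlift_pure (f := fun a b => e a *: b)) => [v|u] k x y /=.
  by rewrite linearP scalerDl scalerA.
by rewrite scalerDr !scalerA mulrC.
Qed.

Lemma counit_r_pure a b : counit_r H (a *t b) = e b *: a.
Proof.
apply: (tlift_pure (f := fun a b => e b *: a)) => [v|u] k x y /=.
  by rewrite scalerDr !scalerA mulrC.
by rewrite linearP scalerDl scalerA.
Qed.

Lemma counit_lM : {morph counit_l H : s t / s * t}.
Proof.
elim/tensor_ind => [a b | s1 s2 IH1 IH2] t; last first.
  by rewrite mulrDl !linearD /= IH1 IH2 mulrDl.
elim/tensor_ind: t => [c d | t1 t2 IH1 IH2]; last first.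
  by rewrite mulrDr !linearD /= IH1 IH2 mulrDr.
rewrite tpureM !counit_l_pure counitM // -scalerAl -scalerAr scalerA.
by rewrite mulrC.
Qed.

Lemma counit_rM : {morph counit_r H : s t / s * t}.
Proof.
elim/tensor_ind => [a b | s1 s2 IH1 IH2] t; last first.
  by rewrite mulrDl !linearD /= IH1 IH2 mulrDl.
elim/tensor_ind: t => [c d | t1 t2 IH1 IH2]; last first.
  by rewrite mulrDr !linearD /= IH1 IH2 mulrDr.
by rewrite tpureM !counit_r_pure counitM // -scalerAl -scalerAr scalerA.
Qed.

Lemma antipode1 : S 1 = 1.
Proof.
have := M1D 1; rewrite comul1 // -tpure1 M_pure counit1 // scale1r.
by rewrite !mul1r.
Qed.

(* S(a_1 b) a_2 = eps(a) S(b) *)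
Let antipode_comulM a b : N 1 (D a * (b *t 1)) = e a *: S b.
Proof.
pose Q (t s : tensor H H) := N 1 (t * (counit_r H s *t 1)).
have QE t s : T (tassoc H H H (t *t 1) * tmap \1%VF D s) = Q t s.
  rewrite /Q; elim/tensor_ind: t => [x1 x2 | t1 t2 IH1 IH2]; last first.
    by rewrite tpureDl linearD /= !mulrDl !linearD /= IH1 IH2.
  elim/tensor_ind: s => [y1 y2 | s1 s2 IH1 IH2]; last first.
    by rewrite !linearD /= tpureDl !mulrDr !linearD /= IH1 IH2.
  rewrite tassoc_pure tmap_pure id_lfunE tpureM T_pure counit_r_pure.
  have -> s : M 1 ((x2 *t 1) * s) = x2 * M 1 s.
    elim/tensor_ind: s => [c d | s1 s2 IH1 IH2]; last first.
      by rewrite mulrDr !linearD /= IH1 IH2 mulrDr.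
    by rewrite tpureM !M_pure mul1r !mulr1 mulrA.
  rewrite M1D tpureM N_pure !mulr1 -!scalerAr !mulr1 linearZ /= -scalerAl.
  by [].
have QE2 t s : T (tassoc H H H (t *t 1 * tmap D \1%VF s))
               = tlift (fun y z => N 1 (t * D y) * S z) s.
  elim/tensor_ind: s => [y z | s1 s2 IH1 IH2]; last first.
    by rewrite linearD mulrDr !linearD /= IH1 IH2.
  rewrite tmap_pure id_lfunE tpureM mul1r T_assoc tlift_pure // => [v|u] k x w.
    by rewrite linearP mulrDr -scalerAr linearP mulrDl -scalerAl.
  by rewrite linearP mulrDr -scalerAr.
have := QE (D a) (D b); rewrite comulA // -tassocM QE2 /Q comul_counit_r // => <-.
transitivity (tlift (fun y z => (e a * e y) *: S z) (D b)).
  rewrite !lfunE; apply: eq_bigr => i _; apply: eq_bigr => j _.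
  by rewrite -comulM // N1D counitM // -scalerAl mul1r.
rewrite -{2}[b]comul_counit_l //; elim/tensor_ind: (D b) => [y z | s t IHs IHt].
  rewrite tlift_pure => [|v k x w|u k x w].
  - by rewrite counit_l_pure linearZ /= scalerA.
  - by rewrite linearP mulrDr scalerDl mulrCA scalerA.
  - by rewrite linearP scalerDr !scalerA mulrC.
by rewrite !linearD /= IHs IHt.
Qed.

Lemma antipodeM a b : S (a * b) = S b * S a.
Proof.
have E1 s : T (tmap \1%VF D s * (b *t 1)) = S (counit_r H s * b).
  elim/tensor_ind: s => [x y | s1 s2 IH1 IH2]; last first.
    by rewrite !linearD /= !mulrDl !linearD /= IH1 IH2.
  rewrite tmap_pure id_lfunE tpureM mulr1 T_pure M1D counit_r_pure.
  by rewrite -scalerAr mulr1 -scalerAl linearZ.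
have E2 s : T (tassoc H H H (tmap D \1%VF s * ((b *t 1) *t 1)))
            = S b * S (counit_l H s).
  elim/tensor_ind: s => [x y | s1 s2 IH1 IH2]; last first.
    by rewrite !linearD /= !mulrDl !linearD /= IH1 IH2 mulrDr.
  rewrite tmap_pure id_lfunE tpureM mulr1 T_assoc antipode_comulM.
  by rewrite counit_l_pure linearZ /= -scalerAl -scalerAr.
rewrite -{1}[a]comul_counit_r // -E1 comulA // -tpure1 -tassoc_pure -tassocM E2.
by rewrite comul_counit_l.
Qed.

Let M_mul z s t : M z (s * t) = M (M z t) s.
Proof.
elim/tensor_ind: s => [a b | s1 s2 IH1 IH2]; last first.
  by rewrite mulrDl !linearD /= IH1 IH2.
rewrite M_pure; elim/tensor_ind: t => [c d | t1 t2 IH1 IH2]; last first.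
  by rewrite mulrDr !linearD /= IH1 IH2 mulrDr mulrDl.
by rewrite tpureM !M_pure antipodeM !mulrA.
Qed.

Let N_mul z s t : N z (s * t) = N (N z s) t.
Proof.
elim/tensor_ind: t => [a b | s1 s2 IH1 IH2]; last first.
  by rewrite mulrDr !linearD /= IH1 IH2.
rewrite N_pure; elim/tensor_ind: s => [c d | t1 t2 IH1 IH2]; last first.
  by rewrite mulrDl !linearD /= IH1 IH2 mulrDr mulrDl.
by rewrite tpureM !N_pure antipodeM !mulrA.
Qed.

Let falg_mul1C (A : falgType K) (x y : A) : x * y = 1 -> y * x = 1.
Proof.
move=> xy1; have ker0 : lker (amull y) == 0%VS.
  apply/lker0P => a b; rewrite !lfunE /= => yab.
  by rewrite -[a]mul1r -[b]mul1r -xy1 -!mulrA yab.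
have yz1 := lker0_lfunVK ker0 1; rewrite lfunE /= in yz1.
suff -> : x = (amull y)^-1%VF 1 by [].
by rewrite -[LHS]mulr1 -{1}yz1 mulrA xy1 mul1r.
Qed.

Variable F : tensor H H.
Hypothesis cF : is_2cocycle F.
Local Notation u := (twist_elt F).
Let FU := cocycle_unit cF.

Let uE : u = M 1 F. Proof. by rewrite M1E. Qed.

Let w := N 1 F^-1.

Let tmap1D_M (s t : tensor H H) :
  tmap (\1%VF : 'End(H)) D (s * t) = tmap \1%VF D s * tmap \1%VF D t.
Proof. by apply: (tmapM (B := H)) => x y; rewrite ?id_lfunE //; apply: comulM. Qed.

Let tmapD1_M (s t : tensor H H) :
  tmap D (\1%VF : 'End(H)) (s * t) = tmap D \1%VF s * tmap D \1%VF t.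
Proof. by apply: (tmapM (A := H)) => x y; rewrite ?id_lfunE //; apply: comulM. Qed.

Let tmap1D_1 : tmap (\1%VF : 'End(H)) D 1 = 1.
Proof. by rewrite -tpure1 tmap_pure id_lfunE comul1. Qed.

Let tmapD1_1 : tmap D (\1%VF : 'End(H)) 1 = 1.
Proof. by rewrite -tpure1 tmap_pure id_lfunE comul1. Qed.

Let tassoc_1 : tassoc H H H 1 = 1.
Proof. by rewrite -!tpure1 tassoc_pure. Qed.

Let counit_l1 : counit_l H 1 = 1.
Proof. by rewrite -tpure1 counit_l_pure counit1 // scale1r. Qed.

Let counit_r1 : counit_r H 1 = 1.
Proof. by rewrite -tpure1 counit_r_pure counit1 // scale1r. Qed.

Let counit_lV : counit_l H F^-1 = 1.
Proof.
by rewrite -[LHS]mul1r -{1}(cocycle_counit_l cF) -counit_lM divrr.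
Qed.

Let counit_rV : counit_r H F^-1 = 1.
Proof.
by rewrite -[LHS]mul1r -{1}(cocycle_counit_r cF) -counit_rM divrr.
Qed.

Let cocycle_swap :
  tassoc H H H (tmap D \1%VF F) * tmap \1%VF D F^-1
  = tassoc H H H (F^-1 *t 1) * (1 *t F).
Proof.
have -> : tassoc H H H (tmap D \1%VF F)
        = tassoc H H H (F^-1 *t 1) * ((1 *t F) * tmap \1%VF D F).
  rewrite cocycleP // -tassocM mulrA tpureM mulVr // mul1r.
  by rewrite (tpure1 (tensor H H : falgType K)) mul1r.
by rewrite -!mulrA -tmap1D_M divrr // tmap1D_1 mulr1.
Qed.

Let wu : w * u = 1.
Proof.
have := congr1 T cocycle_swap.
have TR s t : T (tassoc H H H (s *t 1) * (1 *t t)) = N 1 s * M 1 t.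
  elim/tensor_ind: s => [a b | s1 s2 IH1 IH2]; last first.
    by rewrite tpureDl linearD /= mulrDl !linearD /= IH1 IH2 mulrDl.
  elim/tensor_ind: t => [c d | t1 t2 IH1 IH2]; last first.
    by rewrite tpureDr mulrDr !linearD /= IH1 IH2 mulrDr.
  rewrite tassoc_pure !tpureM mulr1 mul1r T_pure M_pure N_pure M_pure.
  by rewrite !mulr1 !mulrA.
have TL s t : T (tassoc H H H (tmap D \1%VF s) * tmap \1%VF D t)
              = S (counit_r H t) * S (counit_l H s).
  elim/tensor_ind: s => [a b | s1 s2 IH1 IH2]; last first.
    by rewrite !linearD /= mulrDl !linearD /= IH1 IH2 mulrDr.
  elim/tensor_ind: t => [c d | t1 t2 IH1 IH2]; last first.
    by rewrite !linearD /= mulrDr !linearD /= IH1 IH2 mulrDl.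
  rewrite !tmap_pure !id_lfunE counit_l_pure counit_r_pure.
  have TLa r v : T (tassoc H H H (r *t b) * (c *t v))
               = S c * N 1 r * M 1 v * S b.
    elim/tensor_ind: r => [a1 a2 | r1 r2 IH1 IH2]; last first.
      by rewrite tpureDl linearD /= mulrDl !linearD /= IH1 IH2 !(mulrDl, mulrDr).
    elim/tensor_ind: v => [d1 d2 | v1 v2 IH1 IH2]; last first.
      by rewrite tpureDr mulrDr !linearD /= IH1 IH2 !(mulrDl, mulrDr).
    rewrite tassoc_pure !tpureM T_pure !M_pure N_pure !antipodeM !mulr1.
    by rewrite !mulrA.
  rewrite TLa N1D M1D !linearZ /= -!scalerAr -!scalerAl !mulr1.
  by rewrite !scalerA mulrC.
rewrite TL TR counit_rV (cocycle_counit_l cF) antipode1 mulr1.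
by rewrite -uE => /esym.
Qed.

Let uw : u * w = 1. Proof. exact: falg_mul1C wu. Qed.

Lemma twist_elt_unit : u \is a GRing.unit.
Proof. by apply/unitrP; exists w. Qed.

Let uV : u^-1 = w.
Proof. by rewrite -[RHS]mul1r -(mulVr twist_elt_unit) -mulrA uw mulr1. Qed.

Lemma twist_comulE x : comul (twist_data F) x = F * comul H x * F^-1.
Proof.
have lin : linear (fun y => F * comul H y * F^-1).
  by move=> k y z; rewrite linearP mulrDr mulrDl -scalerAr -scalerAl.
pose f := HB.pack_for {linear H -> tensor H H} (fun y => F * comul H y * F^-1)
  (GRing.isSemilinear.Build _ _ _ _ _ (GRing.semilinear_linear lin)).
exact: (lfunE f).
Qed.

Lemma twist_antipodeE x : antipode (twist_data F) x = u * antipode H x * u^-1.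
Proof.
have lin : linear (fun y => u * antipode H y * u^-1).
  by move=> k y z; rewrite linearP mulrDr mulrDl -scalerAr -scalerAl.
pose f := HB.pack_for {linear H -> H} (fun y => u * antipode H y * u^-1)
  (GRing.isSemilinear.Build _ _ _ _ _ (GRing.semilinear_linear lin)).
exact: (lfunE f).
Qed.

Local Notation HF := (twist_data F).

Let twist_comulM : {morph comul HF : x y / x * y}.
Proof.
by move=> x y; rewrite !twist_comulE comulM // !mulrA mulrVK.
Qed.

Let tmap1_twist (t : tensor H H) :
  tmap (\1%VF : 'End(H)) (comul HF) t = (1 *t F) * tmap \1%VF D t * (1 *t F^-1).
Proof.
elim/tensor_ind: t => [a b | s t IHs IHt]; last first.
  by rewrite !linearD /= IHs IHt mulrDr mulrDl.
by rewrite !tmap_pure !id_lfunE twist_comulE !tpureM mul1r mulr1.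
Qed.

Let tmap_twist1 (t : tensor H H) :
  tmap (comul HF) (\1%VF : 'End(H)) t = (F *t 1) * tmap D \1%VF t * (F^-1 *t 1).
Proof.
elim/tensor_ind: t => [a b | s t IHs IHt]; last first.
  by rewrite !linearD /= IHs IHt mulrDr mulrDl.
by rewrite !tmap_pure !id_lfunE twist_comulE !tpureM mul1r mulr1.
Qed.

Let twist_comulA x : tmap \1%VF (comul HF) (comul HF x)
  = tassoc H H H (tmap (comul HF) \1%VF (comul HF x)).
Proof.
rewrite tmap1_twist tmap_twist1 twist_comulE !tmap1D_M !tmapD1_M !mulrA.
rewrite (cocycleP cF) !tassocM comulA // -!mulrA; congr (_ * (_ * (_ * _))).
have r1 : tmap \1%VF D F^-1 * (1 *t F^-1) * ((1 *t F) * tmap \1%VF D F) = 1.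
  rewrite mulrA -[X in X * _]mulrA tpureM mulVr // mulr1.
  by rewrite (tpure1 H (tensor H H : falgType K)) mulr1 -tmap1D_M mulVr // tmap1D_1.
have r2 : (tassoc H H H ((F *t 1) * tmap D \1%VF F)) *
          (tassoc H H H (tmap D \1%VF F^-1) * tassoc H H H (F^-1 *t 1)) = 1.
  rewrite -!tassocM mulrA -[X in X * _]mulrA -tmapD1_M divrr // tmapD1_1 mulr1.
  by rewrite tpureM divrr // mulr1 !tpure1 tassoc_1.
by rewrite -[LHS]mulr1 -r2 -(cocycleP cF) [LHS]mulrA r1 mul1r.
Qed.

Lemma twist_axioms : hopf_axioms (twist_data F).
Proof.
split.
- by rewrite twist_comulE comul1 // mulr1 divrr.
- exact: twist_comulM.
- exact: (counit1 Hax).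
- exact: (counitM Hax).
- exact: twist_comulA.
- move=> x; rewrite twist_comulE -[LHS]/(counit_l H _) !counit_lM counit_lV.
  by rewrite (cocycle_counit_l cF) mul1r mulr1 comul_counit_l.
- move=> x; rewrite twist_comulE -[LHS]/(counit_r H _) !counit_rM counit_rV.
  by rewrite (cocycle_counit_r cF) mul1r mulr1 comul_counit_r.
- move=> x; rewrite twist_comulE.
  have NE t : tlift (fun a b : H => antipode HF a * b) t = u * N u^-1 t.
    rewrite /N !lfunE /= /tlift_fun mulr_sumr; apply: eq_bigr => i _.
    rewrite mulr_sumr; apply: eq_bigr => j _.
    by rewrite twist_antipodeE -scalerAr !mulrA.
  have NF : N u^-1 F = 1.
    by rewrite uV /w -N_mul mulVr // -tpure1 N_pure antipode1 !mulr1.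
  by rewrite NE !N_mul NF N1D ZN -scalerAr -/w uw.
- move=> x; rewrite twist_comulE.
  have ME t : tlift (fun a b : H => a * antipode HF b) t = M u t * u^-1.
    rewrite /M !lfunE /= /tlift_fun mulr_suml; apply: eq_bigr => i _.
    rewrite mulr_suml; apply: eq_bigr => j _.
    by rewrite twist_antipodeE -scalerAl !mulrA.
  have MF : M u F^-1 = 1.
    by rewrite uE -M_mul mulVr // -tpure1 M_pure antipode1 !mulr1.
  by rewrite ME !M_mul MF M1D ZM -uE -scalerAl divrr // twist_elt_unit.
Qed.

End TwistTheory.

Record hopfAlgebra (K : fieldType) := HopfAlgebra {
  hopf_data :> hopfData K;
  hopfP : hopf_axioms hopf_data
}.

Definition twist (K : fieldType) (H : hopfAlgebra K) (F : tensor H H)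
    (cF : is_2cocycle F) : hopfAlgebra K :=
  HopfAlgebra (twist_axioms (hopfP H) cF).

Section TensorPowers.
Variable K : fieldType.

(* The tensor power with m + 1 factors, bracketed to the right. *)
Fixpoint tpow (V : vectType K) (m : nat) : vectType K :=
  if m is m'.+1 then tensor V (tpow V m') else V.

(* The linear map x_1 (x) ... (x) x_(m+1) |-> f [:: x_1; ...; x_(m+1)], for f *)
(* multilinear on the sequences of size m + 1.                                *)
Fixpoint mlift (V W : vectType K) (m : nat) (f : seq V -> W) :
    'Hom(tpow V m, W) :=
  match m return 'Hom(tpow V m, W) with
  | 0 => linfun (fun x : V => f [:: x])
  | m'.+1 => tlift (fun (x : V) (t : tpow V m') =>
                      mlift m' (fun s => f (x :: s)) t)
  end.

(* comul_iter H m is \Delta^{m+1}, with values in the (m+1)-fold power of H. *)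
Fixpoint comul_iter (H : hopfData K) (m : nat) : 'Hom(H, tpow H m) :=
  match m return 'Hom(H, tpow H m) with
  | 0 => \1%VF
  | m'.+1 => (tmap \1%VF (comul_iter H m') \o comul H)%VF
  end.

End TensorPowers.

(* The residue of a modulo n in {1, ..., n}. *)
Definition pos_residue (n : nat) (a : int) : nat :=
  if (a %% n)%Z == 0 then n else `|(a %% n)%Z|%N.

Section Indicator.
Variables (K : fieldType) (H : hopfAlgebra K) (n : nat) (k : int).

(* Sequences are indexed from 0, hence the .-1; the map is used for n > 1, so *)
(* that tpow H n.-2 is the (n-1)-fold tensor power.                           *)
Definition residue_prod : 'Hom(tpow H n.-2, H) :=
  mlift n.-2 (fun s : seq H =>
    \prod_(1 <= i < n) nth 0 s (pos_residue n (i%:Z * k)).-1).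

Definition Ptilde : 'End(H) := (residue_prod \o comul_iter H n.-2)%VF.

Definition lfun_trace (V : vectType K) (f : 'End(V)) : K :=
  \tr (passmx.mxof (vbasis {:V}) (vbasis {:V}) f).

Definition nu_tilde : K := lfun_trace (antipode H \o Ptilde)%VF.

End Indicator.

(* Main.v *)
From HB Require Import structures.
Require Import Defs.
From mathcomp Require Import all_boot all_order all_algebra all_field.
From mathcomp Require Import zify.

Set Implicit Arguments.
Unset Strict Implicit.
Unset Printing Implicit Defensive.

Import GRing.Theory.
Local Open Scope ring_scope.

(** For [b], [a] in the [n]-th tensor power of [H], with factors numbered from 1
    and indices modulo [n], put
    [Psi(b, a) = Tr(x |-> S(b_1 (\prod_(1 <= i < n) a_(ik) x_(ik) b_(ik+1)) a_n))],
    so that [Psi(1, 1)] is the indicator of [H]. Let [F_n] be the element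
    by which twisting conjugates the [n]-fold comultiplication, and write
    [F = f_1 (x) f_2], [F^-1 = g_1 (x) g_2]. Since
    [u S(y) u^-1 = f_1 S(g_1 y f_2) g_2], cyclicity of the trace identifies the
    indicator of [H_F] with [Psi(F_n^-1, F_n)].
    The form [Psi] absorbs the iterated coproduct of [h] to the left of [b] or
    to the right of [a] into the scalar [eps(h)], and a left factor [c] of [a]
    can be moved to the right of [b] as [c' j = c (j + k - 1)].
    By the cocycle equation [F_n = (F_(k-1) (x) F_(n-k+1)) (D (x) D)(F)], with
    iterated coproducts [D] of [k - 1] and [n - k + 1] factors. The cyclic shift
    turns [F_(k-1) (x) F_(n-k+1)] into [F_(n-k+1) (x) F_(k-1)], which cancels
    against [F_n^-1]; the two invariances collapse what remains to
    [u^-1 u = 1]. *)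

(** * Functoriality and reassociation of tensor products *)

Section TensorMaps.
Variable K : fieldType.
Implicit Types U V W : vectType K.

Lemma tmap_comp U U' U'' V V' V'' (f : 'Hom(U', U'')) (g : 'Hom(V', V''))
    (f' : 'Hom(U, U')) (g' : 'Hom(V, V')) t :
  tmap f g (tmap f' g' t) = tmap (f \o f')%VF (g \o g')%VF t.
Proof.
elim/tensor_ind: t => [u v | s t IHs IHt]; last by rewrite !linearD /= IHs IHt.
by rewrite !tmap_pure !comp_lfunE.
Qed.

Lemma tassoc_tmap U U' V V' W W' (f : 'Hom(U, U')) (g : 'Hom(V, V'))
    (h : 'Hom(W, W')) t :
  tassoc U' V' W' (tmap (tmap f g) h t) = tmap f (tmap g h) (tassoc U V W t).
Proof.
elim/tensor_ind: t => [s w | s t IHs IHt]; last by rewrite !linearD /= IHs IHt.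
elim/tensor_ind: s => [u v | s t IHs IHt]; last first.
  by rewrite tpureDl !linearD /= IHs IHt.
by rewrite !tmap_pure !tassoc_pure !tmap_pure.
Qed.

Lemma tassoc1 (A B C : falgType K) : tassoc A B C 1 = 1.
Proof. by rewrite -!tpure1 tassoc_pure. Qed.

Lemma tmap11 (A A' B B' : falgType K) (f : 'Hom(A, A')) (g : 'Hom(B, B')) :
  f 1 = 1 -> g 1 = 1 -> tmap f g 1 = 1.
Proof. by move=> f1 g1; rewrite -!tpure1 tmap_pure f1 g1. Qed.

Definition tassocV U V W : 'Hom(tensor U (tensor V W), tensor (tensor U V) W) :=
  tlift (fun u t => tlift (fun v w => (u *t v) *t w) t).

Lemma tassocV_pure U V W (u : U) (v : V) (w : W) :
  tassocV U V W (u *t (v *t w)) = (u *t v) *t w.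
Proof.
have inner u' v' w' : tlift (fun v w => (u' *t v) *t w) (v' *t w')
                      = (u' *t v') *t w' :> tensor (tensor U V) W.
  apply: (tlift_pure (f := fun v w => (u' *t v) *t w)) => [y|y] a x z /=.
    by rewrite tpureDr tpureZr tpureDl tpureZl.
  by rewrite tpureDr tpureZr.
rewrite /tassocV tlift_pure ?inner // => [t|u'] a x y; last by rewrite linearP.
elim/tensor_ind: t => [v' w' | s t IHs IHt]; last first.
  by rewrite !linearD /= IHs IHt addrACA.
by rewrite !inner !tpureDl !tpureZl.
Qed.

Lemma tassocK U V W : cancel (tassoc U V W) (tassocV U V W).
Proof.
elim/tensor_ind => [s w | s t IHs IHt]; last by rewrite !linearD /= IHs IHt.
elim/tensor_ind: s => [u v | s t IHs IHt]; last first.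
  by rewrite tpureDl !linearD /= IHs IHt.
by rewrite tassoc_pure tassocV_pure.
Qed.

End TensorMaps.

(** * Tensor powers as algebras: concatenation and splitting off the last factor *)

Section TensorPowerAlgebra.
Variables (K : fieldType) (A : falgType K).
Implicit Types (a b m : nat) (f g : nat -> A).

(* The algebra on the space [tpow A m], with m + 1 factors. *)
Fixpoint tpa m : falgType K := if m is m'.+1 then tensor A (tpa m') else A.

(* The pure tensor [f 0 (x) ... (x) f m]; the other values of [f] are ignored. *)
Fixpoint tpf m f : tpa m :=
  match m return tpa m with
  | 0 => f 0%N
  | m'.+1 => f 0%N *t tpf m' (fun i => f i.+1)
  end.

Lemma tpaM m (x y : A) (s t : tpa m) :
  (x *t s : tpa m.+1) * (y *t t) = (x * y) *t (s * t).
Proof. exact: tpureM. Qed.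

Lemma tpa_ind m (P : tpa m -> Prop) :
    (forall f, P (tpf m f)) -> (forall s t, P s -> P t -> P (s + t)) ->
  forall t, P t.
Proof.
elim: m P => [|m IHm] P Pf PD t; first exact: (Pf (fun=> t)).
elim/tensor_ind: t => [u v|]; last exact: PD.
elim/IHm: v => [f | s t Ps Pt]; last by rewrite tpureDr; apply: PD.
exact: (Pf (fun i => if i is j.+1 then f j else u)).
Qed.

Lemma eq_tpf m f g : (forall i, (i <= m)%N -> f i = g i) -> tpf m f = tpf m g.
Proof.
elim: m f g => [|m IHm] f g fg /=; first exact: fg.
by rewrite fg // (IHm _ (fun i => g i.+1)) // => i lim; apply: fg.
Qed.

Lemma tpf1 m : tpf m (fun=> 1) = 1.
Proof. by elim: m => //= m ->; apply: tpure1. Qed.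

Lemma tpfM m f g : tpf m f * tpf m g = tpf m (fun i => f i * g i).
Proof. by elim: m f g => // m IHm f g; rewrite [LHS]tpaM IHm. Qed.

(** Concatenation of [a + 1] with [b + 1] factors. The result has [a + b + 2] factors, hence the
    index [(a + b).+1]. *)
Fixpoint tcat a b : 'Hom(tensor (tpa a) (tpa b), tpa (a + b).+1) :=
  match a return 'Hom(tensor (tpa a) (tpa b), tpa (a + b).+1) with
  | 0 => \1%VF
  | a'.+1 => (tmap \1%VF (tcat a' b) \o tassoc _ _ _)%VF
  end.

Lemma tcat_pure a b f g :
  tcat a b (tpf a f *t tpf b g)
  = tpf (a + b).+1 (fun i => if (i <= a)%N then f i else g (i - a.+1)%N).
Proof.
elim: a f g => [|a IHa] f g.
  rewrite id_lfunE /=; congr (_ *t _); apply: eq_tpf => i _.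
  by rewrite subSS subn0.
rewrite [LHS]comp_lfunE [X in tmap _ _ X]tassoc_pure tmap_pure id_lfunE IHa.
by [].
Qed.

Lemma tcatM a b : {morph tcat a b : s t / s * t}.
Proof.
elim: a => [|a IHa] s t; first by rewrite !id_lfunE.
rewrite !comp_lfunE tassocM; apply: (tmapM (A := A) (B := tensor _ _)) => //.
by move=> x y; rewrite !id_lfunE.
Qed.

Lemma tcat1 a b : tcat a b 1 = 1.
Proof.
elim: a => [|a IHa]; first by rewrite id_lfunE.
rewrite comp_lfunE [X in tmap _ _ X]tassoc1.
by apply: (tmap11 (A := A) (B := tensor _ _)); rewrite ?id_lfunE.
Qed.

(** Powers are bracketed to the right, so the first factor is visible by conversion, whereas the
    last one has to be extracted by this map. *)
Fixpoint tcut m : 'Hom(tpa m.+1, tensor (tpa m) A) :=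
  match m return 'Hom(tpa m.+1, tensor (tpa m) A) with
  | 0 => \1%VF
  | m'.+1 => (tassocV _ _ _ \o tmap \1%VF (tcut m'))%VF
  end.

Lemma tcut_pure m f : tcut m (tpf m.+1 f) = tpf m f *t f m.+1.
Proof.
elim: m f => [|m IHm] f; first by rewrite id_lfunE.
rewrite comp_lfunE [X in tassocV _ _ _ X]tmap_pure id_lfunE.
by rewrite [tcut m _](IHm (fun i => f i.+1)) tassocV_pure.
Qed.

Lemma tcutM m : {morph tcut m : s t / s * t}.
Proof.
elim/tpa_ind => [f | s1 s2 IH1 IH2] t; last first.
  by rewrite mulrDl !linearD /= IH1 IH2 mulrDl.
elim/tpa_ind: t => [g | t1 t2 IH1 IH2]; last first.
  by rewrite mulrDr !linearD /= IH1 IH2 mulrDr.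
by rewrite tpfM !tcut_pure tpureM tpfM.
Qed.

Lemma tcut1 m : tcut m 1 = 1.
Proof. by rewrite -tpf1 tcut_pure tpf1. Qed.

End TensorPowerAlgebra.

Section TensorPowerCast.
Variables (K : fieldType) (A : falgType K) (a b : nat).
Implicit Types (f g : nat -> A).

(* The equation lets [tcatN] identify [(a + b).+1] and [(b + a).+1] factors. *)
Definition tcatN N (e : (a + b).+1 = N) : 'Hom(tensor (tpa A a) (tpa A b), tpa A N) :=
  ecast i 'Hom(tensor (tpa A a) (tpa A b), tpa A i) e (tcat A a b).

Lemma tcatN_pure N (e : (a + b).+1 = N) f g :
  tcatN e (tpf a f *t tpf b g)
  = tpf N (fun i => if (i <= a)%N then f i else g (i - a.+1)%N).
Proof. by case: N / e; apply: tcat_pure. Qed.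

Lemma tcatNM N (e : (a + b).+1 = N) : {morph tcatN e : s t / s * t}.
Proof. by case: N / e; apply: tcatM. Qed.

Lemma tcatN1 N (e : (a + b).+1 = N) : tcatN e 1 = 1.
Proof. by case: N / e; apply: tcat1. Qed.

End TensorPowerCast.

Lemma tcut_tcat (K : fieldType) (A : falgType K) m (e : (m + 0).+1 = m.+1) t :
  tcut A m (tcatN A e t) = t.
Proof.
elim/tensor_ind: t => [s y | s t IHs IHt]; last by rewrite !linearD /= IHs IHt.
elim/tpa_ind: s => [f | s t IHs IHt]; last by rewrite tpureDl !linearD /= IHs IHt.
rewrite -[y]/(tpf 0 (fun=> y)) tcatN_pure tcut_pure ltnn; congr (_ *t _).
by apply: eq_tpf => i ->.
Qed.

(** * Multilinear maps on tensor powers *)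

Section TensorPowerMaps.
Variables (K : fieldType).

Fixpoint tpp (V : vectType K) m (f : nat -> V) : tpow V m :=
  match m return tpow V m with
  | 0 => f 0%N
  | m'.+1 => f 0%N *t tpp m' (fun i => f i.+1)
  end.

Lemma tpow_ind (V : vectType K) m (P : tpow V m -> Prop) :
    (forall f, P (tpp m f)) -> (forall s t, P s -> P t -> P (s + t)) ->
  forall t, P t.
Proof.
elim: m P => [|m IHm] P Pf PD t; first exact: (Pf (fun=> t)).
elim/tensor_ind: t => [u v|]; last exact: PD.
elim/IHm: v => [f | s t Ps Pt]; last by rewrite tpureDr; apply: PD.
exact: (Pf (fun i => if i is j.+1 then f j else u)).
Qed.

Definition multilinear (V W : vectType K) m (f : seq V -> W) :=
  forall s i, size s = m.+1 -> (i <= m)%N -> linear (fun x => f (set_nth 0 s i x)).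

Lemma mlift_pure (V W : vectType K) m (f : seq V -> W) g :
  multilinear m f -> mlift m f (tpp m g) = f (mkseq g m.+1).
Proof.
elim: m f g => [|m IHm] f g fL /=.
  pose h := HB.pack_for {linear V -> W} (fun x => f [:: x])
    (GRing.isSemilinear.Build _ _ _ _ _
       (GRing.semilinear_linear (fL [:: 0] 0%N erefl isT))).
  exact: (lfunE h).
have fLx x : multilinear m (fun s => f (x :: s)).
  by move=> s i sz im; apply: (fL (x :: s) i.+1); rewrite //= sz.
rewrite tlift_pure => [||x a s t]; last by rewrite linearP.
  rewrite IHm // /mkseq -[iota 0 m.+2]/(0%N :: iota (1 + 0) m.+1) iotaDl.
  by rewrite map_cons -map_comp.
move=> t a x y; elim/tpow_ind: t => [h | s t IHs IHt]; last first.
  by rewrite !linearD /= IHs IHt addrACA.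
rewrite !IHm //; apply: (fL (0 :: _) 0%N) => //.
by rewrite /= size_map size_iota.
Qed.

(** A change of type only: for a variable [m] the spaces [tpa A m] and [tpow A m] are not
    convertible, although they agree factor by factor. *)
Fixpoint tpa_tpow (A : falgType K) m : 'Hom(tpa A m, tpow A m) :=
  match m return 'Hom(tpa A m, tpow A m) with
  | 0 => \1%VF
  | m'.+1 => tmap \1%VF (tpa_tpow A m')
  end.

Lemma tpa_tpow_pure (A : falgType K) m g : tpa_tpow A m (tpf m g) = tpp m g.
Proof.
elim: m g => [|m IHm] g /=; first by rewrite id_lfunE.
by rewrite [LHS]tmap_pure id_lfunE IHm.
Qed.

End TensorPowerMaps.

(** * Iterated coproducts and iterated twists *)

Section IteratedComultiplication.
Variables (K : fieldType) (H : hopfData K).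
Hypothesis Hax : hopf_axioms H.
Local Notation D := (comul H).

Fixpoint comul_tpa m : 'Hom(H, tpa H m) :=
  match m return 'Hom(H, tpa H m) with
  | 0 => \1%VF
  | m'.+1 => (tmap \1%VF (comul_tpa m') \o D)%VF
  end.

Lemma comul_iterE m x : comul_iter H m x = tpa_tpow H m (comul_tpa m x).
Proof.
elim: m x => [|m IHm] x /=; first by rewrite !id_lfunE.
rewrite !comp_lfunE [RHS]tmap_comp comp_lfun1l; congr (tmap _ _ _).
by apply/lfunP => y; rewrite comp_lfunE.
Qed.

Lemma comul_tpa1 m : comul_tpa m 1 = 1.
Proof.
elim: m => [|m IHm]; rewrite ?id_lfunE // comp_lfunE comul1 //.
by apply: (tmap11 (A := H) (B := H)); rewrite ?id_lfunE.
Qed.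

Lemma comul_tpaM m : {morph comul_tpa m : x y / x * y}.
Proof.
elim: m => [|m IHm] x y; rewrite ?id_lfunE // !comp_lfunE comulM //.
by apply: (tmapM (A := H) (B := H)) => // s t; rewrite !id_lfunE.
Qed.

Lemma tmap_comulM a b :
  {morph tmap (comul_tpa a) (comul_tpa b) : s t / s * t}.
Proof. by apply: (tmapM (A := H) (B := H)); apply: comul_tpaM. Qed.

Lemma tmap_comul1 a b : tmap (comul_tpa a) (comul_tpa b) 1 = 1.
Proof. by apply: (tmap11 (A := H) (B := H)); apply: comul_tpa1. Qed.

Lemma tassoc_comul a b (t : tensor H H) :
  tassoc _ _ _ (tmap (comul_tpa a.+1) (comul_tpa b) t)
  = tmap \1%VF (tmap (comul_tpa a) (comul_tpa b)) (tassoc _ _ _ (tmap D \1%VF t)).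
Proof. by rewrite -tassoc_tmap tmap_comp comp_lfun1r. Qed.

(** General coassociativity: an iterated coproduct may be split after any factor. Each induction
    step on [a] uses coassociativity once. *)
Lemma tcat_comul a b N (e : (a + b).+1 = N) x :
  tcatN H e (tmap (comul_tpa a) (comul_tpa b) (D x)) = comul_tpa N x.
Proof.
case: N / e; elim: a x => [|a IHa] x; first by rewrite id_lfunE !comp_lfunE.
transitivity (tmap \1%VF (tcat H a b)
  (tassoc _ _ _ (tmap (comul_tpa a.+1) (comul_tpa b) (D x)))).
  exact: comp_lfunE.
transitivity (tmap \1%VF (comul_tpa (a + b).+1) (D x)); last first.
  by rewrite [RHS]comp_lfunE.
(* The induction hypothesis is put as an equality of linear maps, so that it applies inside the
   second tensor factor. *)
have <- : (tcat H a b \o tmap (comul_tpa a) (comul_tpa b) \o D)%VF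
           = comul_tpa (a + b).+1.
  by apply/lfunP => y; rewrite -IHa !comp_lfunE.
by rewrite tassoc_comul -comulA // !tmap_comp !comp_lfun1l.
Qed.

Variable F : tensor H H.
Hypothesis cF : is_2cocycle F.

(** The element [F_(m+1)]. The recursion comes from pulling [F] out of [(id (x) D_F)(F D(x) F^-1)],
    where [D_F] is the iterated coproduct of the twist. *)
Fixpoint twist_tpa m : tpa H m :=
  match m return tpa H m with
  | 0 => 1
  | m'.+1 => (1 *t twist_tpa m') * tmap \1%VF (comul_tpa m') F
  end.

Fixpoint twistV_tpa m : tpa H m :=
  match m return tpa H m with
  | 0 => 1
  | m'.+1 => tmap \1%VF (comul_tpa m') F^-1 * (1 *t twistV_tpa m')
  end.

Lemma twist_tpaK m : twistV_tpa m * twist_tpa m = 1.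
Proof.
elim: m => [|m IHm]; first by rewrite mulr1.
rewrite [LHS](mulrA _ _ _ : _ = _ :> tensor H (tpa H m)) -[X in X * _]mulrA.
(* [comul_tpa 0] is the identity, so the case [a = 0] of [tmap_comulM] covers [id (x) D]. *)
by rewrite tpureM mul1r IHm tpure1 mulr1 -(tmap_comulM 0) mulVr
   ?(cocycle_unit cF) // (tmap_comul1 0).
Qed.

Lemma comul_iter_twist m x :
  comul_iter (twist_data F) m x
  = tpa_tpow H m (twist_tpa m * comul_tpa m x * twistV_tpa m).
Proof.
elim: m x => [|m IHm] x; first by rewrite !id_lfunE mul1r mulr1.
have IHt (t : tensor H H) : tmap \1%VF (comul_iter (twist_data F) m) t
  = tmap \1%VF (tpa_tpow H m)
      ((1 *t twist_tpa m) * tmap \1%VF (comul_tpa m) t * (1 *t twistV_tpa m)).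
  elim/tensor_ind: t => [y z | s t IHs IHt]; last first.
    by rewrite !linearD /= IHs IHt mulrDr mulrDl !linearD.
  by rewrite !tmap_pure !id_lfunE !tpureM tmap_pure id_lfunE IHm mul1r mulr1.
transitivity (tmap \1%VF (comul_iter (twist_data F) m) (comul (twist_data F) x)).
  exact: comp_lfunE.
rewrite IHt twist_comulE !(tmap_comulM 0) -!mulrA.
by congr (tmap _ _ _); rewrite comp_lfunE.
Qed.

(** For [a = 0] this is the definition of [twist_tpa]; the cocycle equation then moves the splitting
    point one factor to the right. *)
Lemma tcat_twist a b N (e : (a + b).+1 = N) :
  twist_tpa N = tcatN H e (twist_tpa a *t twist_tpa b)
              * tcatN H e (tmap (comul_tpa a) (comul_tpa b) F).
Proof.
case: N / e; elim: a => [|a IHa]; first by rewrite !id_lfunE.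
pose P : 'Hom(tensor H _, tensor H (tpa H (a + b).+1)) := tmap \1%VF (tcat H a b).
pose Q : 'Hom(tensor H _, tensor H _) :=
  tmap (\1%VF : 'End(H)) (tmap (comul_tpa a) (comul_tpa b)).
have PM : {morph P : s t / s * t}.
  apply: (tmapM (A := H) (B := tensor _ _)); last exact: tcatM.
  by move=> x y; rewrite !id_lfunE.
have QM : {morph Q : s t / s * t}.
  apply: (tmapM (A := H) (B := tensor H H)); last exact: tmap_comulM.
  by move=> x y; rewrite !id_lfunE.
have tcatE t : tcatN H (erefl (a.+1 + b).+1) t = P (tassoc _ _ _ t).
  exact: comp_lfunE.
have twE : twist_tpa a.+1 *t twist_tpa b
  = ((1 *t twist_tpa a) *t twist_tpa b) * (tmap \1%VF (comul_tpa a) F *t 1).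
  by rewrite tpureM mulr1.
have F1E : tassoc _ _ _ (tmap \1%VF (comul_tpa a) F *t (1 : tpa H b))
           = Q (tassoc _ _ _ (F *t (1 : H))).
  by rewrite -tassoc_tmap tmap_pure comul_tpa1.
rewrite !tcatE tassoc_comul twE tassocM F1E tassoc_pure -PM -mulrA -QM.
(* The factor [(F (x) 1) (D (x) id)(F)] is traded for [(1 (x) F) (id (x) D)(F)]; the part under
   [1 (x) _] is then the induction hypothesis. *)
rewrite -tassocM -(cocycleP cF) QM !PM !mulrA.
transitivity ((1 *t twist_tpa (a + b).+1) * tmap \1%VF (comul_tpa (a + b).+1) F) => //.
congr (_ * _).
  by rewrite -PM /Q tmap_pure /P tpureM tmap_pure !id_lfunE mul1r tcatM IHa.
rewrite /P /Q !tmap_comp !comp_lfun1l.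
have -> // : (tcat H a b \o tmap (comul_tpa a) (comul_tpa b) \o D)%VF
             = comul_tpa (a + b).+1.
by apply/lfunP => y; rewrite -(tcat_comul (erefl (a + b).+1)) !comp_lfunE.
Qed.

End IteratedComultiplication.

(** * Linear maps invariant under the coproduct, and the inverse of [u] *)

Section AntipodeProducts.
Variables (K : fieldType) (H : hopfData K).
Hypothesis Hax : hopf_axioms H.
Local Notation D := (comul H).
Local Notation e := (counit H).
Local Notation S := (antipode H).

Definition mulS_l : 'Hom(tensor H H, H) := tlift (fun a b => S a * b).
Definition mulS_r : 'Hom(tensor H H, H) := tlift (fun a b => a * S b).

Lemma mulS_l_pure a b : mulS_l (a *t b) = S a * b.
Proof.
apply: (tlift_pure (f := fun a b => S a * b)) => [v|u] k x y /=.
  by rewrite linearP mulrDl -scalerAl.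
by rewrite mulrDr -scalerAr.
Qed.

Lemma mulS_r_pure a b : mulS_r (a *t b) = a * S b.
Proof.
apply: (tlift_pure (f := fun a b => a * S b)) => [v|u] k x y /=.
  by rewrite mulrDl -scalerAl.
by rewrite linearP mulrDr -scalerAr.
Qed.

Lemma mulS_l_comul x : mulS_l (D x) = e x *: 1.
Proof. exact: antipode_l. Qed.

Lemma mulS_r_comul x : mulS_r (D x) = e x *: 1.
Proof. exact: antipode_r. Qed.

(* [h (x) y = h_1 (x) h_2 S(h_3) y = D(h_1) (1 (x) S(h_2) y)] *)
Lemma comul_invariant_l (W : vectType K) (f : 'Hom(tensor H H, W)) :
    (forall h t, f (D h * t) = e h *: f t) ->
  forall t, f t = f (1 *t mulS_l t).
Proof.
move=> fD; elim/tensor_ind => [h y | s t IHs IHt]; last first.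
  by rewrite [mulS_l _]linearD tpureDr !linearD /= IHs IHt.
pose R := (amulr y \o mulS_r)%VF.
pose G (s : tensor H H) := tmap (\1%VF : 'End(H)) R (tassoc _ _ _ (tmap D \1%VF s)).
have GD : G (D h) = h *t y.
  rewrite /G -comulA // -{2}[h](comul_counit_r Hax).
  elim/tensor_ind: (D h) => [a b | s t IHs IHt]; last first.
    by rewrite !linearD /= IHs IHt tpureDl.
  rewrite !tmap_pure !id_lfunE comp_lfunE mulS_r_comul lfunE /= counit_r_pure.
  by rewrite -scalerAl mul1r tpureZl tpureZr.
have fG s : f (G s) = f (1 *t (S (counit_l H s) * y)).
  rewrite /G; elim/tensor_ind: s => [a b | s t IHs IHt]; last first.
    by rewrite !linearD /= IHs IHt mulrDl tpureDr linearD.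
  rewrite tmap_pure id_lfunE counit_l_pure linearZ /= -scalerAl tpureZr linearZ /=.
  rewrite -fD; congr (f _).
  elim/tensor_ind: (D a) => [c d | s t IHs IHt]; last first.
    by rewrite tpureDl !linearD /= IHs IHt mulrDl.
  rewrite tassoc_pure tmap_pure id_lfunE comp_lfunE mulS_r_pure lfunE /=.
  by rewrite tpureM mulr1 mulrA.
by rewrite -{1}GD fG comul_counit_l // mulS_l_pure.
Qed.

(* [y (x) h = y S(h_1) h_2 (x) h_3 = (y S(h_1) (x) 1) D(h_2)] *)
Lemma comul_invariant_r (W : vectType K) (f : 'Hom(tensor H H, W)) :
    (forall h t, f (t * D h) = e h *: f t) ->
  forall t, f t = f (mulS_r t *t 1).
Proof.
move=> fD; elim/tensor_ind => [y h | s t IHs IHt]; last first.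
  by rewrite [mulS_r _]linearD tpureDl !linearD /= IHs IHt.
pose R := (amull y \o mulS_l)%VF.
pose G (s : tensor H H) := tmap R (\1%VF : 'End(H)) (tassocV _ _ _ (tmap \1%VF D s)).
have GD : G (D h) = y *t h.
  rewrite /G comulA // tassocK -{2}[h](comul_counit_l Hax).
  elim/tensor_ind: (D h) => [a b | s t IHs IHt]; last first.
    by rewrite !linearD /= IHs IHt tpureDr.
  rewrite !tmap_pure !id_lfunE comp_lfunE mulS_l_comul lfunE /= counit_l_pure.
  by rewrite -scalerAr mulr1 tpureZl tpureZr.
have fG s : f (G s) = f ((y * S (counit_r H s)) *t 1).
  rewrite /G; elim/tensor_ind: s => [a b | s t IHs IHt]; last first.
    by rewrite !linearD /= IHs IHt mulrDr tpureDl linearD.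
  rewrite tmap_pure id_lfunE counit_r_pure linearZ /= -scalerAr tpureZl linearZ /=.
  rewrite -fD; congr (f _).
  elim/tensor_ind: (D b) => [c d | s t IHs IHt]; last first.
    by rewrite tpureDr !linearD /= IHs IHt mulrDr.
  rewrite tassocV_pure tmap_pure id_lfunE comp_lfunE mulS_l_pure lfunE /=.
  by rewrite tpureM mul1r mulrA.
by rewrite -{1}GD fG comul_counit_r // mulS_r_pure.
Qed.

Variable F : tensor H H.
Hypothesis cF : is_2cocycle F.

Lemma counit_r_cocycleV : counit_r H F^-1 = 1.
Proof.
rewrite -[LHS]mul1r -{1}(cocycle_counit_r cF) -(counit_rM Hax) divrr.
  by rewrite -tpure1 counit_r_pure counit1 // scale1r.
exact: cocycle_unit cF.
Qed.

(* The cocycle equation reads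
   [(D (x) id)(F) (id (x) D)(F^-1) = (F^-1 (x) 1) (1 (x) F)]; apply
   [a (x) b (x) c |-> S(a) b S(c)] to both sides. *)
Lemma mulS_l_twistV : mulS_l F^-1 * twist_elt F = 1.
Proof.
have FU := cocycle_unit cF.
pose T : 'Hom(tensor H (tensor H H), H) := tlift (fun a t => S a * mulS_r t).
have T_pure a t : T (a *t t) = S a * mulS_r t.
  apply: (tlift_pure (f := fun a t => S a * mulS_r t)) => [v|u] k x y /=.
    by rewrite linearP mulrDl -scalerAl.
  by rewrite linearP mulrDr -scalerAr.
have TM r q c v : T (tassoc H H H (r *t q) * (c *t v))
                  = S c * mulS_l r * mulS_r v * S q.
  elim/tensor_ind: r => [a1 a2 | r1 r2 IH1 IH2]; last first.
    by rewrite tpureDl linearD /= mulrDl !linearD /= IH1 IH2 !(mulrDl, mulrDr).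
  elim/tensor_ind: v => [d1 d2 | v1 v2 IH1 IH2]; last first.
    by rewrite tpureDr mulrDr !linearD /= IH1 IH2 !(mulrDl, mulrDr).
  rewrite tassoc_pure !tpureM T_pure !mulS_r_pure mulS_l_pure !(antipodeM Hax).
  by rewrite !mulrA.
have TD s t : T (tassoc H H H (tmap D \1%VF s) * tmap \1%VF D t)
              = S (counit_r H t) * S (counit_l H s).
  elim/tensor_ind: s => [a b | s1 s2 IH1 IH2]; last first.
    by rewrite !linearD /= mulrDl !linearD /= IH1 IH2 mulrDr.
  elim/tensor_ind: t => [c d | t1 t2 IH1 IH2]; last first.
    by rewrite !linearD /= mulrDr !linearD /= IH1 IH2 mulrDl.
  rewrite !tmap_pure !id_lfunE counit_l_pure counit_r_pure TM.
  rewrite mulS_l_comul mulS_r_comul !linearZ /= -!scalerAr -!scalerAl !mulr1.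
  by rewrite !scalerA mulrC.
have DM : {morph tmap (\1%VF : 'End(H)) D : s t / s * t}.
  by apply: (tmapM (A := H) (B := H)); [move=> x y; rewrite !id_lfunE | apply: comulM].
have D1 : tmap (\1%VF : 'End(H)) D 1 = 1.
  by apply: (tmap11 (A := H) (B := H)); rewrite ?id_lfunE ?comul1.
have swap : tassoc H H H (tmap D \1%VF F) * tmap \1%VF D F^-1
            = tassoc H H H (F^-1 *t 1) * (1 *t F).
  have -> : tassoc H H H (tmap D \1%VF F)
          = tassoc H H H (F^-1 *t 1) * ((1 *t F) * tmap \1%VF D F).
    rewrite (cocycleP cF) -tassocM mulrA tpureM mulVr // mul1r.
    by rewrite (tpure1 (tensor H H : falgType K)) mul1r.
  by rewrite -!mulrA -DM divrr // D1 mulr1.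
have := TD F F^-1; rewrite swap TM counit_r_cocycleV (cocycle_counit_l cF).
by rewrite (antipode1 Hax) !mulr1 mul1r.
Qed.

End AntipodeProducts.

(** * The trace of an endomorphism *)

Section Trace.
Variables (K : fieldType) (V : vectType K).

Lemma lfun_trace_linear : linear (@lfun_trace K V : _ -> K^o).
Proof.
by move=> a f g; rewrite /lfun_trace passmx.mxof_linear mxtraceD mxtraceZ.
Qed.

Lemma lfun_traceD (f g : 'End(V)) : lfun_trace (f + g) = lfun_trace f + lfun_trace g.
Proof. by have := lfun_trace_linear 1 f g; rewrite !scale1r. Qed.

Lemma lfun_traceZ a (f : 'End(V)) : lfun_trace (a *: f) = a *: (lfun_trace f : K^o).
Proof.
have tr0 : lfun_trace (0 : 'End(V)) = 0.
  by apply: (addrI (lfun_trace (0 : 'End(V)))); rewrite -lfun_traceD !addr0.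
by rewrite -[a *: f]addr0 lfun_trace_linear tr0 addr0.
Qed.

Lemma lfun_traceC (f g : 'End(V)) : lfun_trace (f \o g)%VF = lfun_trace (g \o f)%VF.
Proof.
by rewrite /lfun_trace !(passmx.mxof_comp _ _ (vbasisP _)) mxtrace_mulC.
Qed.

End Trace.

(** * The trace form and its two invariances *)

Section TraceForm.
Variables (K : fieldType) (H : hopfData K) (m : nat) (M : 'Hom(tpa H m, H)).
Hypothesis Hax : hopf_axioms H.
Local Notation D := (comul_tpa H m).
Local Notation e := (counit H).
Local Notation S := (antipode H).

(* [M] multiplies the factors of a tensor in some order, so that [b], [t], [s]
   and [a] occupy the slots around the factors of [D x]. *)
Definition slot_end (b : H) (t s : tpa H m) (a : H) : 'End(H) :=
  (S \o (amull b \o amulr a) \o M \o (amull s \o amulr t) \o D)%VF.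

Lemma slot_endE b t s a x : slot_end b t s a x = S (b * (M (s * (D x * t)) * a)).
Proof. by rewrite !comp_lfunE !lfunE. Qed.

(** The form [Psi] for [n = m + 2]: the first factor of [b] and the last factor of [a] are the outer
    ones, and the remaining [m + 1] factors of each surround those of [D x]. *)
Definition slot_form :
    'Hom(tensor H (tpa H m), 'Hom(tensor (tpa H m) H, K^o)) :=
  tlift (fun b t => tlift (W := K^o) (fun s a => lfun_trace (slot_end b t s a))).

Lemma slot_form_pure b t s a :
  slot_form (b *t t) (s *t a) = lfun_trace (slot_end b t s a).
Proof.
have inner b' t' s' a' :
    tlift (W := K^o) (fun s a => lfun_trace (slot_end b' t' s a)) (s' *t a')
    = lfun_trace (slot_end b' t' s' a').
  apply: (tlift_pure (W := K^o)
            (f := fun s a => lfun_trace (slot_end b' t' s a))) => [v|v] k x y /=.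
    rewrite -lfun_trace_linear; apply: (congr1 (@lfun_trace K H)); apply/lfunP => z.
    rewrite add_lfunE scale_lfunE !slot_endE.
    by rewrite mulrDl -scalerAl linearP mulrDl mulrDr -scalerAl -scalerAr linearP.
  rewrite -lfun_trace_linear; apply: (congr1 (@lfun_trace K H)); apply/lfunP => z.
  rewrite add_lfunE scale_lfunE !slot_endE.
  by rewrite !mulrDr -!scalerAr linearP.
rewrite /slot_form tlift_pure ?inner // => [v|v] k x y; apply/lfunP;
  elim/tensor_ind => [s' a' | s1 s2 IH1 IH2]; rewrite ?linearD /= ?IH1 ?IH2 //;
  rewrite add_lfunE scale_lfunE !inner -lfun_trace_linear;
  apply: (congr1 (@lfun_trace K H)); apply/lfunP => z;
  rewrite add_lfunE scale_lfunE !slot_endE.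
- by rewrite mulrDl -scalerAl linearP.
- by rewrite !mulrDr -!scalerAr linearP mulrDl mulrDr -scalerAl -scalerAr linearP.
Qed.

Lemma slot_formDl b1 b2 a : slot_form (b1 + b2) a = slot_form b1 a + slot_form b2 a.
Proof. by rewrite linearD add_lfunE. Qed.

(** The factor [h_1] leaves the antipode as [S(h_1)] on the right, and [h_2] is absorbed as
    [D(x h_2)]. Cyclicity of the trace brings them together as right multiplication by [S(h_1) h_2],
    which is [eps(h)]. *)
Lemma slot_form_comul_l h b :
  slot_form (tmap \1%VF D (comul H h) * b) = e h *: slot_form b.
Proof.
apply/lfunP; elim/tensor_ind => [s a | s1 s2 IH1 IH2]; last first.
  by rewrite !linearD /= IH1 IH2.
elim/tensor_ind: b => [b t | s1 s2 IH1 IH2]; last first.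
  rewrite mulrDr slot_formDl IH1 IH2 !scale_lfunE slot_formDl.
  by rewrite scalerDr.
(* An arbitrary [r] replaces the coproduct of [h], so that it can be reduced to pure tensors. *)
have trE r : slot_form (tmap \1%VF D r * (b *t t)) (s *t a)
             = lfun_trace (amulr (mulS_l H r) \o slot_end b t s a)%VF.
  elim/tensor_ind: r => [h1 h2 | r1 r2 IH1 IH2]; last first.
    rewrite linearD mulrDl slot_formDl IH1 IH2 -[LHS]lfun_traceD -comp_lfunDl.
    by rewrite -linearD -linearD.
  rewrite tmap_pure tpureM id_lfunE slot_form_pure mulS_l_pure.
  transitivity (lfun_trace ((amulr (S h1) \o slot_end b t s a) \o amulr h2)%VF).
    apply: (congr1 (@lfun_trace K H)); apply/lfunP => x.
    rewrite [RHS]comp_lfunE [in RHS]comp_lfunE [in RHS]lfunE /= slot_endE.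
    rewrite [LHS]slot_endE [amulr h2 x]lfunE /= -(antipodeM Hax) (comul_tpaM Hax).
    by rewrite !mulrA.
  rewrite lfun_traceC comp_lfunA.
  apply: (congr1 (fun f => lfun_trace (f \o slot_end b t s a)%VF)).
  by apply/lfunP => x; rewrite comp_lfunE !lfunE /= mulrA.
rewrite trE (mulS_l_comul Hax) scale_lfunE slot_form_pure.
rewrite -[RHS]lfun_traceZ; apply: (congr1 (@lfun_trace K H)); apply/lfunP => x.
by rewrite comp_lfunE scale_lfunE lfunE /= -scalerAr mulr1.
Qed.

(** Mirror image: [h_1] is absorbed as [D(h_1 x)], [h_2] leaves as [S(h_2)] on the left, and
    cyclicity produces [h_1 S(h_2)]. *)
Lemma slot_form_comul_r h b a :
  slot_form b (a * tmap D \1%VF (comul H h)) = e h *: slot_form b a.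
Proof.
elim/tensor_ind: a => [s a | s1 s2 IH1 IH2]; last first.
  by rewrite mulrDl !linearD /= IH1 IH2.
elim/tensor_ind: b => [b t | s1 s2 IH1 IH2]; last first.
  by rewrite !slot_formDl IH1 IH2 scalerDr.
have trE r : slot_form (b *t t) ((s *t a) * tmap D \1%VF r)
             = lfun_trace (amull (mulS_r H r) \o slot_end b t s a)%VF.
  elim/tensor_ind: r => [h1 h2 | r1 r2 IH1 IH2]; last first.
    rewrite linearD mulrDr linearD /= IH1 IH2 -[LHS]lfun_traceD -comp_lfunDl.
    by rewrite -linearD -linearD.
  rewrite tmap_pure tpureM id_lfunE slot_form_pure mulS_r_pure.
  transitivity (lfun_trace ((amull (S h2) \o slot_end b t s a) \o amull h1)%VF).
    apply: (congr1 (@lfun_trace K H)); apply/lfunP => x.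
    rewrite [RHS]comp_lfunE [in RHS]comp_lfunE [in RHS]lfunE /= slot_endE.
    rewrite [LHS]slot_endE [amull h1 x]lfunE /= -(antipodeM Hax) (comul_tpaM Hax).
    by rewrite !mulrA.
  rewrite lfun_traceC comp_lfunA.
  apply: (congr1 (fun f => lfun_trace (f \o slot_end b t s a)%VF)).
  by apply/lfunP => x; rewrite comp_lfunE !lfunE /= mulrA.
rewrite trE (mulS_r_comul Hax) slot_form_pure.
rewrite -[RHS]lfun_traceZ; apply: (congr1 (@lfun_trace K H)); apply/lfunP => x.
by rewrite comp_lfunE scale_lfunE lfunE /= -scalerAl mul1r.
Qed.

(* Cyclicity of the trace moves the outer factors inside the argument of
   [D]: [f_1 S(f_2) S(y) S(g_1) g_2 = f_1 S(g_1 y f_2) g_2]. *)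
Lemma trace_mulS (A B : tpa H m) (s t : tensor H H) (f : 'End(H)) :
    (forall x, f x = mulS_r H s * S (M (A * D x * B)) * mulS_l H t) ->
  lfun_trace f = slot_form (tmap \1%VF D t * (1 *t B)) ((A *t 1) * tmap D \1%VF s).
Proof.
move=> fE; have {f fE}-> : f = (amull (mulS_r H s) \o amulr (mulS_l H t)
              \o (S \o M \o (amull A \o amulr B) \o D))%VF.
  apply/lfunP => x.
  by rewrite fE !comp_lfunE ![amull _ _]lfunE ![amulr _ _]lfunE /= !mulrA.
elim/tensor_ind: s => [f1 f2 | s1 s2 IH1 IH2]; last first.
  rewrite !linearD /= mulrDr linearD /= -IH1 -IH2 -[RHS]lfun_traceD.
  by rewrite !comp_lfunDl.
elim/tensor_ind: t => [g1 g2 | s1 s2 IH1 IH2]; last first.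
  rewrite !linearD /= mulrDl slot_formDl -IH1 -IH2 -[RHS]lfun_traceD.
  by rewrite comp_lfunDr comp_lfunDl.
rewrite !tmap_pure !tpureM !id_lfunE mulr1 mul1r slot_form_pure.
rewrite mulS_l_pure mulS_r_pure.
transitivity (lfun_trace
  ((amull f1 \o amulr g2) \o slot_end g1 B A f2)%VF).
  apply: (congr1 (@lfun_trace K H)); apply/lfunP => x.
  rewrite [RHS]comp_lfunE slot_endE !comp_lfunE !lfunE /=.
  by rewrite !(antipodeM Hax) !mulrA.
rewrite lfun_traceC; apply: (congr1 (@lfun_trace K H)); apply/lfunP => x.
rewrite comp_lfunE !slot_endE comp_lfunE !lfunE /=.
by rewrite !(comul_tpaM Hax) !mulrA.
Qed.

End TraceForm.

(** * Multiplication by [k] modulo [n], and cyclic shifts of products *)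

Section ResidueProduct.
Variables (n k : nat).
Hypotheses (n_gt0 : (0 < n)%N) (k_gt0 : (0 < k)%N) (cop_nk : coprime n k).

Lemma modn_coprime_gt0 i : (0 < i < n)%N -> (0 < i * k %% n)%N.
Proof.
case/andP=> i_gt0 ltin; rewrite lt0n -/(dvdn n _) Gauss_dvdl //.
by rewrite gtnNdvd.
Qed.

Lemma modn_coprime_inj i j :
  (i < n)%N -> (j < n)%N -> (i * k = j * k %[mod n])%N -> i = j.
Proof.
wlog leij : i j / (i <= j)%N => [wl | ltin ltjn].
  have [/wl // | /ltnW/wl sym ltin ltjn /esym eqm] := leqP i j.
  by apply/esym/sym.
move/esym/eqP; rewrite eqn_mod_dvd ?leq_mul2r ?leij ?orbT // -mulnBl.
rewrite Gauss_dvdl // => /dvdn_leq.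
case: (posnP (j - i)) => [ji0 _ | ji_gt0 /(_ isT)].
  by apply/eqP; rewrite eqn_leq leij -subn_eq0 ji0.
by rewrite leqNgt (leq_ltn_trans (leq_subr _ _) ltjn).
Qed.

Lemma modn_coprime_surj j : (0 < j < n)%N -> exists2 i, (0 < i < n)%N & (i * k %% n)%N = j.
Proof.
case/andP=> j_gt0 ltjn.
pose f (i : 'I_n) := Ordinal (ltn_pmod (i * k)%N n_gt0).
have injf : injective f.
  by move=> i i' [/modn_coprime_inj eqi]; apply/val_inj/eqi.
exists (invF injf (Ordinal ltjn)); last exact: (congr1 val (f_invF injf (Ordinal ltjn))).
rewrite ltn_ord andbT lt0n; apply: contraTneq j_gt0 => i0.
by have := congr1 val (f_invF injf (Ordinal ltjn)); rewrite /= i0 mod0n => <-.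
Qed.

Lemma modn_predn a : (0 < a %% n)%N -> (a.-1 %% n = (a %% n).-1)%N.
Proof.
move=> a_gt0; have lta := ltn_pmod a n_gt0.
rewrite {1}(divn_eq a n) -subn1 -addnBA // modnMDl subn1 modn_small //.
exact: leq_ltn_trans (leq_pred _) lta.
Qed.

(* [c' j = c (j + k - 1)] is the shift for which the factor [c'] to the right
   of each slot of the left-hand side is [c] to the left of the next slot. *)
Lemma prod_shift (A : pzRingType) (a b x c c' : nat -> A) :
    (forall j, (j < n)%N -> c' j = c ((j + k.-1) %% n)%N) ->
  b 0%N * c' 0%N * (\prod_(1 <= i < n)
     (a (i * k %% n)%N.-1 * (x (i * k %% n)%N.-1 * (b (i * k %% n)%N * c' (i * k %% n)%N)))
     * a n.-1)
  = b 0%N * (\prod_(1 <= i < n)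
     (c (i * k %% n)%N.-1 * a (i * k %% n)%N.-1 * (x (i * k %% n)%N.-1 * b (i * k %% n)%N))
     * (c n.-1 * a n.-1)).
Proof.
move=> c'E; rewrite !mulrA; congr (_ * _).
have next i : c' (i * k %% n)%N = c ((i.+1 * k).-1 %% n)%N.
  by rewrite c'E ?ltn_pmod // modnDml mulSnr -!subn1 addnBA.
(* For a partial product the two sides differ by the trailing factor [c' (j * k %% n)], which
   becomes the leading factor [c] of the next slot. *)
suff IH j : (j < n)%N -> b 0%N * c' 0%N * (\prod_(1 <= i < j.+1)
     (a (i * k %% n)%N.-1 * (x (i * k %% n)%N.-1 * (b (i * k %% n)%N * c' (i * k %% n)%N))))
  = b 0%N * (\prod_(1 <= i < j.+1)
     (c (i * k %% n)%N.-1 * a (i * k %% n)%N.-1 * (x (i * k %% n)%N.-1 * b (i * k %% n)%N)))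
     * c' (j * k %% n)%N.
  have ltn1 : (n.-1 < n)%N by rewrite prednK.
  have := IH _ ltn1; rewrite prednK // next prednK // => ->.
  (* The last trailing factor is [c] at [n * k - 1], which is [n - 1] modulo [n]: the factor next to
     [a n.-1]. *)
  suff -> : (n * k).-1 = (k.-1 * n + n.-1)%N by rewrite modnMDl modn_small.
  by rewrite -{1}(prednK k_gt0) mulnS addnC mulnC -!subn1 addnBA.
elim: j => [|j IHj] ltjn; first by rewrite !big_geq // !mulr1 mul0n mod0n.
rewrite !(big_nat_recr j.+1) // [LHS]mulrA IHj; last exact: ltnW.
rewrite next modn_predn; last exact: modn_coprime_gt0.
by rewrite -!mulrA.
Qed.

End ResidueProduct.

Section ResidueIndex.
Variables (n : nat) (k : int).
Hypotheses (n_gt1 : (1 < n)%N) (cop_nk : coprimez n%:Z k).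

Lemma modz_absE : (k %% n)%Z = `|(k %% n)%Z|%N.
Proof. by rewrite gez0_abs // modz_ge0 // -lt0n ltnW. Qed.

Lemma coprime_residue : coprime n `|(k %% n)%Z|.
Proof.
move: cop_nk; rewrite /coprimez -gcdz_modr modz_absE.
by rewrite /gcdz !absz_nat.
Qed.

Lemma residue_gt0 : (0 < `|(k %% n)%Z|)%N.
Proof.
move: coprime_residue n_gt1; case: `|_|%N => //.
by rewrite /coprime gcdn0 => /eqP->.
Qed.

Lemma residue_ltn : (`|(k %% n)%Z| < n)%N.
Proof. by rewrite -ltz_nat -modz_absE ltz_pmod // ltz_nat ltnW. Qed.

(** By coprimality [i * k] is nonzero modulo [n], so the exceptional value [n] of [pos_residue] does
    not occur. *)
Lemma pos_residueE i :
  (0 < i < n)%N -> pos_residue n (i%:Z * k) = (i * `|(k %% n)%Z| %% n)%N.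
Proof.
move=> lt_in; rewrite /pos_residue -modzMmr modz_absE -PoszM modz_nat absz_nat.
by have := modn_coprime_gt0 coprime_residue lt_in; case: (_ %% n)%N.
Qed.

End ResidueIndex.

(** * The trace form for the product taken in the order [k, 2k, ...] *)

Section Permuted.
Variables (K : fieldType) (H : hopfAlgebra K) (m : nat) (k : int).
Hypothesis cop_nk : coprimez m.+2 k.
Local Notation kk := `|(k %% m.+2)%Z|%N.
Let n_gt1 : (1 < m.+2)%N. Proof. by []. Qed.
Let cop := coprime_residue n_gt1 cop_nk.
Let kk_gt0 := residue_gt0 n_gt1 cop_nk.

Definition mul_tpa : 'Hom(tpa H m, H) := (residue_prod H m.+2 k \o tpa_tpow H m)%VF.

Lemma mul_tpa_pure w :
  mul_tpa (tpf m w) = \prod_(1 <= i < m.+2) w (i * kk %% m.+2)%N.-1.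
Proof.
rewrite comp_lfunE tpa_tpow_pure mlift_pure => [|s j sz lejm].
  apply: eq_big_nat => i lt_in; rewrite (pos_residueE n_gt1 cop_nk lt_in).
  by rewrite nth_mkseq // -ltnS prednK ?ltn_pmod // modn_coprime_gt0.
(* Linearity in slot [j], numbered [j + 1] from 1: this slot occurs at exactly one position [i0],
   where the product is split. *)
have [i0 lt_i0n i0E] := modn_coprime_surj (ltn0Sn m.+1) cop (lejm : 0 < j.+1 < m.+2)%N.
have [i0_gt0 i0n] := andP lt_i0n.
have nthE (y : H) i : (0 < i < m.+2)%N -> i != i0 ->
    nth 0 (set_nth 0 s j y) (pos_residue m.+2 (i%:Z * k)).-1
    = nth 0 s (pos_residue m.+2 (i%:Z * k)).-1.
  move=> lt_in /eqP ne_i; rewrite nth_set_nth /= (pos_residueE n_gt1 cop_nk lt_in).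
  case: eqP => // ij; case: ne_i.
  have := modn_coprime_gt0 cop lt_in; have [_ i_n] := andP lt_in.
  move=> /prednK; rewrite ij -i0E => eqm; apply/esym.
  exact: (modn_coprime_inj cop i0n i_n eqm).
pose P a b := \prod_(a <= i < b) nth 0 s (pos_residue m.+2 (i%:Z * k)).-1.
suff fE y : \prod_(1 <= i < m.+2) nth 0 (set_nth 0 s j y) (pos_residue m.+2 (i%:Z * k)).-1
            = P 1%N i0 * (y * P i0.+1 m.+2).
  by move=> a x y; rewrite !fE mulrDl mulrDr -scalerAl -scalerAr.
rewrite (big_cat_nat i0_gt0 (ltnW i0n)) /= (big_ltn i0n); congr (_ * (_ * _)).
- apply: eq_big_nat => i /andP[i_gt0 lt_i]; rewrite nthE ?(ltn_eqF lt_i) //.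
  by rewrite i_gt0 (ltn_trans lt_i).
- by rewrite (pos_residueE n_gt1 cop_nk lt_i0n) i0E nth_set_nth /= eqxx.
- apply: eq_big_nat => i /andP[lt_i i_n]; rewrite nthE ?(gtn_eqF lt_i) //.
  by rewrite i_n (leq_ltn_trans _ lt_i).
Qed.

Local Notation form := (slot_form mul_tpa).

(** By linearity in [a], [b] and [D x] this reduces to pure tensors, where it is [prod_shift]. *)
Lemma slot_form_shift (c c' : nat -> H) b a :
    (forall j, (j < m.+2)%N -> c' j = c ((j + kk.-1) %% m.+2)%N) ->
  form (b * tpf m.+1 c') (tcut H m a) = form b (tcut H m (tpf m.+1 c * a)).
Proof.
move=> c'E.
elim/tpa_ind: a => [a | a1 a2 IH1 IH2]; last first.
  by rewrite mulrDr !linearD /= IH1 IH2.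
elim/(@tpa_ind K H m.+1): b => [b | b1 b2 IH1 IH2]; last first.
  by rewrite mulrDl !slot_formDl IH1 IH2.
rewrite !tpfM !tcut_pure.
rewrite [LHS]slot_form_pure [RHS]slot_form_pure.
apply: (congr1 (@lfun_trace K H)); apply/lfunP => x; rewrite !slot_endE.
congr (antipode H _).
elim/tpa_ind: (comul_tpa H m x) => [y | s t IHs IHt]; last first.
  by rewrite !(mulrDl, mulrDr, linearD) /= IHs IHt.
rewrite !tpfM !mul_tpa_pure.
have prodE (u v : nat -> H) : \prod_(1 <= i < m.+2)
    (u (i * kk %% m.+2)%N.-1 * (y (i * kk %% m.+2)%N.-1 * v (i * kk %% m.+2)%N.-1.+1))
  = \prod_(1 <= i < m.+2)
    (u (i * kk %% m.+2)%N.-1 * (y (i * kk %% m.+2)%N.-1 * v (i * kk %% m.+2)%N)).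
  by apply: eq_big_nat => i lt_in; rewrite prednK // modn_coprime_gt0.
rewrite (prodE a (fun i => b i * c' i)) (prodE (fun i => c i * a i) b).
exact: (prod_shift (ltn0Sn m.+1) kk_gt0 cop a b y c'E).
Qed.

(** Here [k - 1 = c + 1], so the cyclic shift by [k - 1] places exchanges the leading block of
    [c + 1] factors with the remaining [d + 1]. *)
Lemma slot_form_rot c d (e1 : (c + d).+1 = m.+1) (e2 : (d + c).+1 = m.+1) s t b a :
    kk = c.+2 ->
  form (b * tcatN H e2 (t *t s)) (tcut H m a)
  = form b (tcut H m (tcatN H e1 (s *t t) * a)).
Proof.
move=> kkE.
elim/tpa_ind: s => [f | s1 s2 IH1 IH2]; last first.
  rewrite tpureDr tpureDl !linearD /= mulrDr mulrDl slot_formDl IH1 IH2.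
  by rewrite linearD /= linearD.
elim/tpa_ind: t => [g | s1 s2 IH1 IH2]; last first.
  rewrite tpureDr tpureDl !linearD /= mulrDr mulrDl slot_formDl IH1 IH2.
  by rewrite linearD /= linearD.
rewrite !tcatN_pure; apply: slot_form_shift => j ltj.
have mE : m = (c + d)%N by case: e1.
rewrite kkE /=; case: leqP => [le_jd | lt_dj].
  by rewrite modn_small ?ifF; [congr g | |]; lia.
have -> : (j + c.+1 = j - d.+1 + m.+2)%N by lia.
by rewrite modnDr modn_small ?ifT //; lia.
Qed.

End Permuted.

(** * Comparison of the indicators of [H] and of its twist *)

Section Twisting.
Variables (K : fieldType) (H : hopfAlgebra K) (m : nat) (k : int).
Hypothesis cop_nk : coprimez m.+2 k.
Variable F : tensor H H.
Hypothesis cF : is_2cocycle F.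
Local Notation kk := `|(k %% m.+2)%Z|%N.
Local Notation form := (slot_form (mul_tpa H m k)).
Let Hax := hopfP H.

Lemma nu_tilde_form : nu_tilde H m.+2 k = form 1 (tcut H m 1).
Proof.
rewrite tcut1 -!tpure1 slot_form_pure /nu_tilde.
apply: (congr1 (@lfun_trace K H)); apply/lfunP => x.
by rewrite slot_endE /Ptilde /mul_tpa !comp_lfunE comul_iterE !mul1r !mulr1.
Qed.

(** Splitting off the last factor of [F_n] gives [(F_(n-1) (x) 1) (D (x) id)(F)], and [F_n^-1] is
    [(id (x) D)(F^-1) (1 (x) F_(n-1)^-1)] by definition. These are the arguments produced by
    [trace_mulS]. *)
Lemma nu_tilde_twist_form :
  nu_tilde (twist cF) m.+2 k
  = form (twistV_tpa F m.+1) (tcut H m (twist_tpa F m.+1)).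
Proof.
have e : (m + 0).+1 = m.+1 by rewrite addn0.
rewrite (tcat_twist Hax cF e) tcutM !tcut_tcat.
have := @trace_mulS K H m (mul_tpa H m k) Hax (twist_tpa F m) (twistV_tpa F m)
  F F^-1 (antipode (twist_data F) \o Ptilde (twist cF) m.+2 k)%VF.
apply => x.
have uE : mulS_l H F^-1 = (twist_elt F)^-1.
  rewrite -[LHS]mulr1 -(divrr (twist_elt_unit Hax cF)) mulrA.
  by rewrite (mulS_l_twistV Hax cF) mul1r.
rewrite uE comp_lfunE /Ptilde comp_lfunE comul_iter_twist // [mul_tpa _ _ _ _]comp_lfunE.
exact: twist_antipodeE.
Qed.

Lemma slot_form_comulM_l h b :
  form (comul_tpa H m.+1 h * b) = counit H h *: form b.
Proof. by rewrite -(slot_form_comul_l _ Hax) [comul_tpa _ _ _]comp_lfunE. Qed.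

Lemma slot_form_comulM_r h b a :
  form b (tcut H m (a * comul_tpa H m.+1 h)) = counit H h *: form b (tcut H m a).
Proof.
have e : (m + 0).+1 = m.+1 by rewrite addn0.
by rewrite -(slot_form_comul_r _ Hax) tcutM -(tcat_comul Hax e) tcut_tcat.
Qed.

(** Applied to a coproduct, the concatenated [D (x) D] is the full iterated coproduct. Hence the
    form is invariant in [s] and in [t], and each can be collapsed to a single factor. *)
Lemma slot_form_comul_invariant c d (e1 : (c + d).+1 = m.+1)
    (e2 : (d + c).+1 = m.+1) (s t : tensor H H) :
  form (tcatN H e2 (tmap (comul_tpa H d) (comul_tpa H c) s))
       (tcut H m (tcatN H e1 (tmap (comul_tpa H c) (comul_tpa H d) t)))
  = form (tcatN H e2 (1 *t comul_tpa H c (mulS_l H s)))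
         (tcut H m (tcatN H e1 (comul_tpa H c (mulS_r H t) *t 1))).
Proof.
pose f : 'Hom(tensor H H, 'Hom(tensor (tpa H m) H, K^o)) :=
  (form \o tcatN H e2 \o tmap (comul_tpa H d) (comul_tpa H c))%VF.
pose g b : 'Hom(tensor H H, K^o) :=
  (form b \o tcut H m \o tcatN H e1 \o tmap (comul_tpa H c) (comul_tpa H d))%VF.
have fE r : f r = form (tcatN H e2 (tmap (comul_tpa H d) (comul_tpa H c) r)).
  by rewrite /f !comp_lfunE.
have gE b r : g b r
    = form b (tcut H m (tcatN H e1 (tmap (comul_tpa H c) (comul_tpa H d) r))).
  by rewrite /g !comp_lfunE.
have fD h r : f (comul H h * r) = counit H h *: f r.
  by rewrite !fE (tmap_comulM Hax) tcatNM (tcat_comul Hax) slot_form_comulM_l.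
have gD b h r : g b (r * comul H h) = counit H h *: g b r.
  by rewrite !gE (tmap_comulM Hax) tcatNM (tcat_comul Hax) slot_form_comulM_r.
rewrite -fE (comul_invariant_l Hax fD) fE -gE (comul_invariant_r Hax (gD _)) gE.
by rewrite !tmap_pure !(comul_tpa1 Hax).
Qed.

Lemma slot_form_twist :
  form (twistV_tpa F m.+1) (tcut H m (twist_tpa F m.+1)) = form 1 (tcut H m 1).
Proof.
have twK := twist_tpaK Hax cF m.+1.
have := residue_ltn k (isT : 1 < m.+2)%N.
have := residue_gt0 (isT : 1 < m.+2)%N cop_nk.
case kkE: kk => [|[|c]] // _ ltcm.
  (* For [k = 1] modulo [n] the shift is trivial, so [F_n] moves unchanged next to [F_n^-1]. *)
  have shift (b t : tpa H m.+1) : form (b * t) (tcut H m 1) = form b (tcut H m t).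
    elim/(@tpa_ind K H m.+1): t => [f | s t IHs IHt].
      rewrite -[tpf _ f in RHS]mulr1.
      rewrite (slot_form_shift cop_nk (c := f)) // => j ltj.
      by rewrite kkE addn0 modn_small.
    by rewrite mulrDr slot_formDl !linearD /= IHs IHt.
  by rewrite -shift twK.
pose d := (m - c)%N.
have e1 : (c + d).+1 = m.+1 by rewrite /d; lia.
have e2 : (d + c).+1 = m.+1 by rewrite /d; lia.
pose X := tcatN H e1 (twist_tpa F c *t twist_tpa F d).
pose Y (r : tensor H H) := tcatN H e1 (tmap (comul_tpa H c) (comul_tpa H d) r).
pose X' := tcatN H e2 (twist_tpa F d *t twist_tpa F c).
pose Y' (r : tensor H H) := tcatN H e2 (tmap (comul_tpa H d) (comul_tpa H c) r).
(* From [F_n = X' Y'(F)] it follows that [F_n^-1 X'] is the inverse of [Y'(F)]. *)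
have VX' : twistV_tpa F m.+1 * X' = Y' F^-1.
  have YY : Y' F * Y' F^-1 = 1.
    by rewrite /Y' -tcatNM -(tmap_comulM Hax) divrr ?(cocycle_unit cF) //
       (tmap_comul1 Hax) tcatN1.
  by rewrite -[LHS]mulr1 -YY mulrA -[_ * X' * _]mulrA -(tcat_twist Hax cF e2) twK mul1r.
rewrite (tcat_twist Hax cF e1) -(slot_form_rot cop_nk e1 e2) // -/X' VX'.
(* What remains is [1 (x) D(u^-1)] on the left and [D(u) (x) 1] on the right; a second rotation
   joins them into [1 (x) D(u^-1 u)]. *)
rewrite slot_form_comul_invariant -[tcatN H e1 _]mulr1.
rewrite -(slot_form_rot cop_nk e1 e2) // -tcatNM tpureM mulr1 -(comul_tpaM Hax).
by rewrite (mulS_l_twistV Hax cF) (comul_tpa1 Hax) tpure1 tcatN1.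
Qed.

End Twisting.

Theorem theorem6p2 (K : fieldType) (H : hopfAlgebra K) (F : tensor H H)
    (cF : is_2cocycle F) (n : nat) (k : int) :
  (1 < n)%N -> coprimez n%:Z k ->
  nu_tilde (twist cF) n k = nu_tilde H n k.
Proof.
case: n => [|[|m]] // _ cop_nk.
exact: (etrans (nu_tilde_twist_form m k cF)
          (etrans (slot_form_twist cop_nk cF) (esym (nu_tilde_form H m k)))).
Qed.
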